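(* Let $\Lambda=\langle a_1\rangle\perp\langle a_2\rangle=\mathcal{O}_Ds_1\perp\mathcal{O}_Ds_2$ be a skew-hermitian lattice with $|2a_1|\ge|a_2|$ and $N(a_2)\in N(a_1)k^{*2}$, and let $t$ be the integer with $\nu(\pi^t)=\mu(\Lambda)=\nu(a_2)-\nu(a_1)$. The following are equivalent: (1) $H(\Lambda)=k^*$; (2) there exists $(s;\sigma)\in\mathcal{B}(\Lambda)$ with $N(\sigma)\notin N(k(a_1)^* )$; (3) there exists $r\in\mathcal{O}_D$ such that $\left(\frac{N(1-r),\,-N(a_1)}{\mathfrak{p}}\right)=-1$, $N(z)N(a_1)\in k^{*2}$ and $N(z)N(\pi^ta_1)^{-1}\in\mathcal{O}_k$, where $z=a_1-ra_1\bar r$.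
   Context: $k$ is a dyadic local field of characteristic $0$ with ring of integers $\mathcal{O}_k$, uniformizer $\pi$, normalized valuation $\nu_k$; $\left(\frac{x,y}{\mathfrak{p}}\right)$ is the Hilbert symbol of $k$. $D$ is the quaternion division algebra over $k$, with involution $q\mapsto\bar q$, reduced norm $N$; $|q|:=|N(q)|_k$, $\nu(q):=\nu_k(N(q))$, $\mathcal{O}_D=\{q:|q|\le 1\}$. A skew-hermitian space is a free $D$-module $V$ with nondegenerate $h$, $D$-linear in the first variable, $h(x,y)=-\overline{h(y,x)}$; $\langle a_1\rangle\perp\langle a_2\rangle=\mathcal{O}_Ds_1\perp\mathcal{O}_Ds_2$ means $h(s_i,s_i)=a_i$ (pure quaternions), $h(s_1,s_2)=0$. Simple rotation: for $s\in V$, $\sigma\in D^*$ with $\sigma-\bar\sigma=h(s,s)$, $(s;\sigma)(x)=x-h(x,s)\sigma^{-1}s$; the spinor norm $\theta$ on the isometry group satisfies $\theta((s;\sigma))=N(\sigma)k^{*2}$. $\mathcal{U}^+_k(\Lambda)$ is the stabilizer of $\Lambda$ in the isometry group; $H(\Lambda)\supseteq k^{*2}$ is defined by $H(\Lambda)/k^{*2}=\theta(\mathcal{U}^+_k(\Lambda))$. $\mathcal{B}(\Lambda)$ is the set of simple rotations $(s;\sigma)\in\mathcal{U}^+_k(\Lambda)$ for which there exist $m\in\{1,2\}$, $r\in\mathcal{O}_D$ with $|1-r|\ge|2|$, and $s_0\in\mathcal{O}_Ds_{m+1}\perp\cdots$ (i.e. $s_0=\lambda s_2$ with $\lambda\in\mathcal{O}_D$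 if $m=1$, $s_0=0$ if $m=2$) such that $s=(1-r)s_m-s_0$ and $\sigma=a_m(1-\bar r)$. *)

(* Defs.v *)
From mathcomp Require Import all_boot all_order all_algebra.
From mathcomp Require Import boolp.
Set Implicit Arguments. Unset Strict Implicit. Unset Printing Implicit Defensive.
Import Order.TTheory GRing.Theory Num.Theory.
Local Open Scope ring_scope.

(* The base field: a dyadic local field of characteristic 0, given by a    *)
(* field k together with its normalized discrete valuation v (the value    *)
(* v 0 is irrelevant; 0 is treated as having valuation +oo everywhere).    *)
Section Field.
Variable k : fieldType.
Variable v : k -> int.

Definition integral (x : k) : Prop := x = 0 \/ 0 <= v x.

Definition absle (x y : k) : Prop := x = 0 \/ (y <> 0 /\ v y <= v x).

Definition is_nzsq (x : k) : Prop := exists u : k, u <> 0 /\ x = u ^+ 2.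

Record dyadic_local_field : Prop := {
  dlf_char0 : forall n : nat, (n.+1)%:R <> (0 : k);
  dlf_mul : forall x y : k, x <> 0 -> y <> 0 -> v (x * y) = v x + v y;
  dlf_add : forall x y : k, x <> 0 -> y <> 0 -> x + y <> 0 ->
              Num.min (v x) (v y) <= v (x + y);
  dlf_surj : exists p : k, p <> 0 /\ v p = 1;
  dlf_complete : forall u : nat -> k,
     (forall M : int, exists N : nat, forall m n, (N <= m)%N -> (N <= n)%N ->
        u m = u n \/ M <= v (u m - u n)) ->
     exists l : k, forall M : int, exists N : nat, forall n, (N <= n)%N ->
        u n = l \/ M <= v (u n - l);
  dlf_residue_finite : exists s : seq k, (forall y, y \in s -> integral y) /\
     forall x, integral x -> exists y, y \in s /\ (x = y \/ 1 <= v (x - y));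
  dlf_dyadic : 0 < v 2
}.

Definition hilbert (x y : k) : int :=
  if `[< exists z u w : k, (z, u, w) <> (0, 0, 0) /\
          z ^+ 2 = x * u ^+ 2 + y * w ^+ 2 >] then 1 else -1.
End Field.

(* The quaternion algebra (a,b)_k with basis 1, i, j, ij,                  *)
(* i^2 = a, j^2 = b, ij = -ji.                                              *)
Record quat (k : Type) := Quat { q0 : k; q1 : k; q2 : k; q3 : k }.

Section Quat.
Variable k : fieldType.
Variables a b : k.

Definition qscal (c : k) : quat k := Quat c 0 0 0.
Definition qzero : quat k := qscal 0.
Definition qone : quat k := qscal 1.
Definition qadd (x y : quat k) : quat k :=
  Quat (q0 x + q0 y) (q1 x + q1 y) (q2 x + q2 y) (q3 x + q3 y).
Definition qopp (x : quat k) : quat k := Quat (- q0 x) (- q1 x) (- q2 x) (- q3 x).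
Definition qsub (x y : quat k) : quat k := qadd x (qopp y).
Definition qmul (x y : quat k) : quat k :=
  Quat (q0 x * q0 y + a * q1 x * q1 y + b * q2 x * q2 y - a * b * q3 x * q3 y)
       (q0 x * q1 y + q1 x * q0 y - b * q2 x * q3 y + b * q3 x * q2 y)
       (q0 x * q2 y + q2 x * q0 y + a * q1 x * q3 y - a * q3 x * q1 y)
       (q0 x * q3 y + q3 x * q0 y + q1 x * q2 y - q2 x * q1 y).
Definition qconj (x : quat k) : quat k := Quat (q0 x) (- q1 x) (- q2 x) (- q3 x).
Definition qnorm (x : quat k) : k :=
  q0 x ^+ 2 - a * q1 x ^+ 2 - b * q2 x ^+ 2 + a * b * q3 x ^+ 2.
Definition qinv (x : quat k) : quat k :=
  let c := (qnorm x)^-1 in Quat (c * q0 x) (- c * q1 x) (- c * q2 x) (- c * q3 x).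
Definition pure (x : quat k) : Prop := q0 x = 0.

Definition quat_division : Prop :=
  a <> 0 /\ b <> 0 /\
  forall x : quat k, x <> qzero -> exists y, qmul x y = qone.

(* N(k(c)^* ) : reduced norms of nonzero elements of the subfield k(c) *)
Definition norm_from (c : quat k) (n : k) : Prop :=
  exists x y : k, (x, y) <> (0, 0) /\
     n = qnorm (qadd (qscal x) (qmul (qscal y) c)).

(* The skew-hermitian space V = D s1 + D s2 with h(s_i,s_i) = a_i,          *)
(* h(s1,s2) = 0; vectors are coordinate pairs (x1, x2) = x1 s1 + x2 s2.     *)
Definition vec := (quat k * quat k)%type.

Definition vadd (x y : vec) : vec := (qadd x.1 y.1, qadd x.2 y.2).
Definition vsub (x y : vec) : vec := (qsub x.1 y.1, qsub x.2 y.2).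
Definition vscal (q : quat k) (x : vec) : vec := (qmul q x.1, qmul q x.2).

Variables a1 a2 : quat k.

Definition herm (x y : vec) : quat k :=
  qadd (qmul (qmul x.1 a1) (qconj y.1)) (qmul (qmul x.2 a2) (qconj y.2)).

Definition rot (s : vec) (sigma : quat k) (x : vec) : vec :=
  vsub x (vscal (qmul (herm x s) (qinv sigma)) s).

Definition rot_data (s : vec) (sigma : quat k) : Prop :=
  sigma <> qzero /\ qsub sigma (qconj sigma) = herm s s.

Variable v : k -> int.

Definition qintegral (q : quat k) : Prop := integral v (qnorm q).

Definition in_lattice (x : vec) : Prop := qintegral x.1 /\ qintegral x.2.

Definition stabilizes (g : vec -> vec) : Prop :=
  (forall x, in_lattice x -> in_lattice (g x)) /\
  (forall y, in_lattice y -> exists x, in_lattice x /\ g x = y).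

Definition rot_prod (l : seq (vec * quat k)) : vec -> vec :=
  foldr (fun p f => rot p.1 p.2 \o f) id l.
Definition norm_prod (l : seq (vec * quat k)) : k :=
  foldr (fun p c => qnorm p.2 * c) 1 l.

Fixpoint all_rot_data (l : seq (vec * quat k)) : Prop :=
  if l is p :: l' then rot_data p.1 p.2 /\ all_rot_data l' else True.

(* H(Lambda): c in H(Lambda) iff c k^{*2} = theta(g) for some g in the
   stabilizer of Lambda, g written as a product of simple rotations. *)
Definition in_H (c : k) : Prop :=
  c <> 0 /\ exists l : seq (vec * quat k),
    all_rot_data l /\
    stabilizes (rot_prod l) /\
    exists u : k, u <> 0 /\ c = norm_prod l * u ^+ 2.

Definition in_B (s : vec) (sigma : quat k) : Prop :=
  rot_data s sigma /\ stabilizes (rot s sigma) /\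
  exists r : quat k, qintegral r /\
    absle v (qnorm (qscal 2)) (qnorm (qsub qone r)) /\
    ( (exists lam : quat k, qintegral lam /\
         s = (qsub qone r, qopp lam) /\ sigma = qmul a1 (qsub qone (qconj r)))
    \/ (s = (qzero, qsub qone r) /\ sigma = qmul a2 (qsub qone (qconj r))) ).
End Quat.

(* Main.v *)
Require Import Defs.
From HB Require Import structures.
From mathcomp Require Import all_boot all_order all_algebra.
From mathcomp Require Import boolp.
From mathcomp Require Import zify ring.
Import Order.TTheory GRing.Theory Num.Theory.
Set Implicit Arguments. Unset Strict Implicit. Unset Printing Implicit Defensive.
Local Open Scope ring_scope.

(** Write [K = k(a1)].  Two facts carry the proof.

    First, [N(K^* )] has index at most 2 in [k^*]: filtering the units by their
    distance to 1, every level but one is exhausted by norms up to the next level,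
    and at the exceptional level the norms are the image of [x^2 + x], of index 2 in
    the finite residue field.  As a consequence every pure quaternion whose norm is
    [N(a2)] up to squares has the form [l a2 l^bar]; in particular the plane is
    isotropic.

    Second, the spinor norm modulo [N(K^* )] can be read on isotropic vectors: if
    [w] is isotropic, the norm of its first coordinate is multiplied by [N(sigma)],
    modulo [N(K^* )], under the rotation [(s; sigma)].  Hence the class of a product of
    rotations depends only on the isometry.

    (1) => (2): if [g] stabilizes the lattice and [g s1 = r s1 + lam s2], the rotation
    with [s = s1 - g s1] maps [s1] to [g s1], lies in [B] when [|1 - r| >= |2|] (replace
    [g] by [-g] otherwise), and differs from [g] by an isometry fixing [s1], whose class
    is trivial.  (2) => (3): [z = lam a2 lam^bar].  (3) => (1): conversely [z] is of that
    form with [lam] integral, which gives a rotation stabilizing the lattice of class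
    outside [N(K^* )], while all of [N(K^* )] comes from the isometries of [<a1>]. *)

(** * Valuation and the local square theorem *)

Section Valuation.
Variables (k : fieldType) (v : k -> int) (hk : dyadic_local_field v).

Definition vge (n : int) (x : k) : Prop := x = 0 \/ n <= v x.

Lemma two_neq0 : (2 : k) != 0.
Proof. by apply/eqP; exact: (dlf_char0 hk (n := 1%N)). Qed.

Lemma v_mul x y : x != 0 -> y != 0 -> v (x * y) = v x + v y.
Proof. by move=> /eqP x0 /eqP y0; exact: (dlf_mul hk). Qed.

Lemma v_one : v 1 = 0.
Proof. have h : v 1 = v 1 + v 1 by rewrite -v_mul ?oner_neq0 // mulr1.
lia. Qed.

Lemma v_inv x : x != 0 -> v x^-1 = - v x.
Proof.
move=> x0; have := v_mul x0 (_ : x^-1 != 0); rewrite invr_eq0 x0 divff // v_one.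
move=> /(_ isT); lia.
Qed.

Lemma v_opp x : v (- x) = v x.
Proof.
have [->|x0] := eqVneq x 0; first by rewrite oppr0.
have n1 : (-1 : k) != 0 by rewrite oppr_eq0 oner_neq0.
have := v_mul n1 n1; rewrite mulrNN mulr1 v_one => h.
by rewrite -mulN1r v_mul //; lia.
Qed.

Lemma v_sqr x : x != 0 -> v (x ^+ 2) = v x + v x.
Proof. by move=> x0; rewrite expr2 v_mul. Qed.

Lemma vge0 n : vge n 0. Proof. by left. Qed.

Lemma vge_val x : vge (v x) x. Proof. by right. Qed.

Lemma vge_le m n x : m <= n -> vge n x -> vge m x.
Proof. by move=> mn [->|h]; [left | right; apply: le_trans h]. Qed.

Lemma vge_valE n x : x != 0 -> vge n x -> n <= v x.
Proof. by move=> /eqP x0 []. Qed.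

Lemma vgeD n x y : vge n x -> vge n y -> vge n (x + y).
Proof.
have [->|x0] := eqVneq x 0; first by rewrite add0r.
have [->|y0] := eqVneq y 0; first by rewrite addr0.
move=> /(vge_valE x0) hx /(vge_valE y0) hy.
have [->|xy0] := eqVneq (x + y) 0; first by left.
right; have := dlf_add hk (elimN eqP x0) (elimN eqP y0) (elimN eqP xy0).
by apply: le_trans; rewrite le_min hx.
Qed.

Lemma vgeN n x : vge n x -> vge n (- x).
Proof. by case=> [->|h]; [left; rewrite oppr0 | right; rewrite v_opp]. Qed.

Lemma vgeB n x y : vge n x -> vge n y -> vge n (x - y).
Proof. by move=> hx /vgeN; exact: vgeD. Qed.

Lemma vgeM m n x y : vge m x -> vge n y -> vge (m + n) (x * y).
Proof.
have [->|x0] := eqVneq x 0; first by rewrite mul0r; left.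
have [->|y0] := eqVneq y 0; first by rewrite mulr0; left.
move=> /(vge_valE x0) hx /(vge_valE y0) hy.
by right; rewrite v_mul //; apply: lerD.
Qed.

Lemma vge_mul l m n x y : l <= m + n -> vge m x -> vge n y -> vge l (x * y).
Proof. by move=> h hx hy; apply: vge_le h _; exact: vgeM. Qed.

Lemma vge_sqr n x : vge n x -> vge (n + n) (x ^+ 2).
Proof. by move=> h; rewrite expr2; exact: vgeM. Qed.

Lemma vge_sqr_inv x : vge 0 (x ^+ 2) -> vge 0 x.
Proof.
have [->|x0] := eqVneq x 0; first by left.
by move=> h; right; have := vge_valE (expf_neq0 2 x0) h; rewrite v_sqr //; lia.
Qed.

Lemma vge_div n x y : y != 0 -> vge n x -> vge (n - v y) (x / y).
Proof. by move=> y0 h; apply: vgeM h _; right; rewrite v_inv. Qed.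

Lemma val_perturb x y : x != 0 -> vge (v x + 1) y -> x + y != 0 /\ v (x + y) = v x.
Proof.
move=> x0 hy.
have s0 : x + y != 0.
  apply/eqP => s; have yx : y = - x by apply/eqP; rewrite -addr_eq0 addrC s.
  move: hy; rewrite yx => /vge_valE; rewrite oppr_eq0 x0 v_opp => /(_ isT); lia.
split=> //; apply/eqP; rewrite eq_le; apply/andP; split; last first.
  by apply: (vge_valE s0); apply: vgeD; [right | apply: vge_le hy; lia].
rewrite leNgt; apply/negP => lt.
have : vge (v x + 1) x.
  rewrite [X in vge _ X](_ : x = (x + y) - y); last by ring.
  by apply: vgeB => //; right; lia.
by move=> /(vge_valE x0); lia.
Qed.

Lemma unit_perturb n u : 0 < n -> vge n (u - 1) -> u != 0 /\ v u = 0.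
Proof.
move=> n0 h; have := @val_perturb 1 (u - 1) (oner_neq0 k).
rewrite v_one [1 + _]addrC subrK; apply; apply: vge_le h; lia.
Qed.

Lemma exists_val (n : int) : exists x, x != 0 /\ v x = n.
Proof.
have [p [/eqP p0 vp]] := dlf_surj hk.
have nat_case (m : nat) : v (p ^+ m) = m%:Z.
  elim: m => [|m IH]; first by rewrite expr0 v_one.
  by rewrite exprS v_mul ?expf_neq0 // IH vp; lia.
case: n => m; first by exists (p ^+ m); rewrite expf_neq0.
exists (p ^- m.+1); rewrite invr_eq0 expf_neq0 // v_inv ?expf_neq0 // nat_case; split=> //; lia.
Qed.

(* The root is the limit of the iteration [t := y - t ^+ 2]. *)
Lemma artin_schreier_root y : vge 1 y -> exists t, vge 1 t /\ t ^+ 2 + t = y.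
Proof.
move=> hy.
have [u [u0 uS]] : exists u : nat -> k, u 0%N = 0 /\ forall n, u n.+1 = y - u n ^+ 2.
  by exists (fun n => iter n (fun t => y - t ^+ 2) 0).
have u1 n : vge 1 (u n).
  elim: n => [|n IH]; first by rewrite u0; left.
  by rewrite uS; apply: vgeB => //; apply: vge_le (vge_sqr IH); lia.
have step n : vge n%:Z (u n.+1 - u n).
  elim: n => [|n IH]; first by rewrite u0 subr0; apply: vge_le (u1 1%N); lia.
  have -> : u n.+2 - u n.+1 = - ((u n.+1 - u n) * (u n.+1 + u n)) by rewrite !uS; ring.
  apply: vgeN; apply: vge_mul IH (vgeD (u1 _) (u1 _)); lia.
have far n m : vge n%:Z (u (m + n)%N - u n).
  elim: m => [|m IH]; first by rewrite subrr; left.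
  have -> : u (m.+1 + n)%N - u n = (u (m + n).+1 - u (m + n)%N) + (u (m + n)%N - u n).
    by rewrite addSn; ring.
  apply: vgeD IH; apply: vge_le (step _); lia.
have [|l hl] := dlf_complete hk (u := u).
  move=> M; exists `|M|%N => m n hm hn.
  have : vge M (u m - u n).
    have -> : u m - u n = (u m - u `|M|%N) - (u n - u `|M|%N) by ring.
    apply: vgeB; [rewrite -(subnK hm)|rewrite -(subnK hn)]; apply: vge_le (far _ _); lia.
  by case=> [/eqP|]; [rewrite subr_eq0 => /eqP; left | right].
have hl' M : exists N : nat, forall n, (N <= n)%N -> vge M (u n - l).
  have [N hN] := hl M; exists N => n /hN [->|]; first by left; rewrite subrr.
  by right.
have l1 : vge 1 l.
  have [N /(_ N (leqnn N)) h] := hl' 1.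
  rewrite [X in vge _ X](_ : l = u N - (u N - l)); last by ring.
  exact: vgeB.
exists l; split=> //; apply/eqP; rewrite -subr_eq0; apply/eqP.
have big M : vge M (l ^+ 2 + l - y).
  have [N hN] := hl' `|M|%:Z.
  have -> : l ^+ 2 + l - y = - ((u N - l) * (u N + l)) - (u N.+1 - l) by rewrite uS; ring.
  apply: vgeB; last by apply: vge_le (hN _ (leqnSn N)); lia.
  apply: vgeN; apply: vge_mul (hN _ (leqnn N)) (vgeD (u1 N) l1); lia.
have [//|n0] := eqVneq (l ^+ 2 + l - y) 0.
by have := vge_valE n0 (big (v (l ^+ 2 + l - y) + 1)); lia.
Qed.

(** The identity [(1 + 2 * t) ^+ 2 = 1 + 4 * (t ^+ 2 + t)] turns the square root into an
    Artin-Schreier equation with right-hand side in the maximal ideal. *)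
Lemma square_near1 u : vge (v 2 + v 2 + 1) (u - 1) -> exists w, w != 0 /\ u = w ^+ 2.
Proof.
move=> hu; have t0 := two_neq0; have d0 := dlf_dyadic hk.
have [|t [t1 ht]] := @artin_schreier_root ((u - 1) / 2 ^+ 2).
  by apply: vge_le (vge_div (expf_neq0 2 t0) hu); rewrite v_sqr //; lia.
exists (1 + 2 * t); split.
  have h : vge 1 (1 + 2 * t - 1).
    rewrite addrAC subrr add0r; apply: vge_le (vgeM (vge_val 2) t1); lia.
  by case: (unit_perturb _ h).
by rewrite -[LHS](subrK 1) -[u - 1](mulfVK (expf_neq0 2 t0)) -ht; ring.
Qed.

End Valuation.

(** * Residue field *)

Section ResidueField.
Variables (k : fieldType) (v : k -> int) (hk : dyadic_local_field v).
Local Notation vge := (vge v).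

(** Only the finite set underlying the residue field is built; its arithmetic is done on lifts,
    modulo the maximal ideal. *)
Lemma residue_system : exists (S : finType) (red : k -> S) (lift : S -> k),
  [/\ forall i, vge 0 (lift i), forall i, red (lift i) = i &
      forall x y, vge 0 x -> vge 0 y -> red x = red y <-> vge 1 (x - y)].
Proof.
have [s [s_int s_rep]] := dlf_residue_finite hk.
pose cong x y := vge 1 (x - y).
have cong_refl x : cong x x by rewrite /cong subrr; left.
have cong_sym x y : cong x y -> cong y x by rewrite /cong -[y - x]opprB; exact: (vgeN hk).
have cong_trans x y z : cong x y -> cong y z -> cong x z.
  by move=> h1 h2; rewrite /cong (_ : x - z = (x - y) + (y - z)); [exact: (vgeD hk) | ring].
pose rep x := nth 0 s (find (fun y => `[< cong x y >]) s).
have has_rep x : vge 0 x -> has (fun y => `[< cong x y >]) s.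
  move=> /s_rep [y [ys xy]]; apply/hasP; exists y => //; apply/asboolP.
  by case: xy => [->|]; [exact: cong_refl | right].
have rep_cong x : vge 0 x -> cong x (rep x).
  by move=> /has_rep /(nth_find 0) /asboolP.
have rep_mem x : vge 0 x -> rep x \in s.
  by move=> /has_rep h; rewrite mem_nth // -has_find.
have rep_eq x y : cong x y -> rep x = rep y.
  move=> xy; congr (nth _ _ _); apply: eq_find => z; apply/asbool_equiv_eq; split.
    exact/cong_trans/cong_sym.
  exact: cong_trans.
pose P := [pred y | `[< vge 0 y >] && (rep y == y)].
pose s' := filter P s.
have rep_in x : vge 0 x -> rep x \in s'.
  move=> x0; rewrite mem_filter rep_mem // andbT; apply/andP; split.
    by apply/asboolP/s_int/rep_mem.
  by apply/eqP/esym/rep_eq/rep_cong.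
have in_s' y : y \in s' -> vge 0 y /\ rep y = y.
  by rewrite mem_filter => /andP[/andP[/asboolP ? /eqP ?] _].
(* Default value for [insubd]: the reduction map is meaningful on integral elements only. *)
pose z0 : seq_sub s' := SeqSub (rep_in 0 (vge0 _ _)).
exists (seq_sub s' : finType), (fun x => insubd z0 (rep x)), val; split.
- by case=> y /= /in_s' [].
- by case=> y /= ys; apply: val_inj; rewrite val_insubd /=; case: (in_s' _ ys) => _ ->; rewrite ys.
- move=> x y x0 y0; split.
    move=> /(congr1 val); rewrite !val_insubd !rep_in // => h.
    by apply: (cong_trans _ (rep x)); [exact: rep_cong | rewrite h; apply/cong_sym/rep_cong].
  by move=> xy; congr (insubd _ _); exact: rep_eq.
Qed.

(** In residue characteristic 2 squaring is injective on the residue field, hence bijective because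
    that field is finite. *)
Lemma residue_sqrt x : vge 0 x -> exists y, vge 0 y /\ vge 1 (y ^+ 2 - x).
Proof.
move=> x0; have d0 := dlf_dyadic hk.
have [S [red [lift [lift0 liftK redE]]]] := residue_system.
have sq0 y : vge 0 y -> vge 0 (y ^+ 2) by move=> h; exact: (vge_sqr hk h).
pose f i := red (lift i ^+ 2).
have f_inj : injective f.
  move=> i j /redE => /(_ (sq0 _ (lift0 i)) (sq0 _ (lift0 j))) h.
  rewrite -(liftK i) -(liftK j); apply/redE => //.
  have dij := vgeB hk (lift0 i) (lift0 j).
  have : vge 1 ((lift i - lift j) ^+ 2).
    rewrite (_ : _ ^+ 2 = (lift i ^+ 2 - lift j ^+ 2) - 2 * ((lift i - lift j) * lift j)); last by ring.
    apply: (vgeB hk) h _; apply: (vge_mul hk) (vge_val v 2) (vgeM hk dij (lift0 j)); lia.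
  have [->|n0] := eqVneq (lift i - lift j) 0; first by left.
  by move=> /(vge_valE (expf_neq0 2 n0)); rewrite (v_sqr hk) // => h2; right; lia.
have [g _ fK] := injF_bij f_inj.
exists (lift (g (red x))); split=> //; apply/redE => //; first exact: sq0.
exact: (fK (red x)).
Qed.

(* [x ^+ 2 + x] is additive modulo the maximal ideal, with kernel of order 2, so
   its image has index 2 in the residue field. *)
Lemma residue_artin_schreier r r' : vge 0 r -> vge 0 r' ->
  exists x, vge 0 x /\ [\/ vge 1 (x ^+ 2 + x - r), vge 1 (x ^+ 2 + x - r')
                         | vge 1 (x ^+ 2 + x - (r + r'))].
Proof.
move=> r0 r0'; have d0 := dlf_dyadic hk.
have [S [red [lift [lift0 liftK redE]]]] := residue_system.
pose p (x : k) := x ^+ 2 + x.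
have p0 y : vge 0 y -> vge 0 (p y).
  by move=> h; apply: (vgeD hk) => //; exact: (vge_sqr hk h).
have two1 y : vge 0 y -> vge 1 (2 * y).
  by move=> h; apply: (vge_mul hk) (vge_val v 2) h; lia.
have p_add x y : vge 0 x -> vge 0 y -> vge 1 (p (x - y) - (p x - p y)).
  move=> x0 y0; rewrite (_ : _ - _ = 2 * (y ^+ 2 - x * y)); last by rewrite /p; ring.
  by apply: two1; apply: (vgeB hk) (vge_sqr hk y0) (vgeM hk x0 y0).
have p_ker x : vge 0 x -> vge 1 (p x) -> vge 1 x \/ vge 1 (x - 1).
  move=> x0; have [->|n0] := eqVneq x 0; first by left; left.
  have [->|n1] := eqVneq (x - 1) 0; first by right; left.
  have xV : x + 1 != 0 \/ x + 1 = 0 by case: eqVneq; [right|left].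
  case: xV => [n1'|e]; last first.
    move=> _; right; rewrite (_ : x - 1 = (x + 1) - 2 * 1); last by ring.
    by rewrite e; apply: (vgeB hk); [left | apply: two1; right; rewrite (v_one hk)].
  rewrite /p (_ : x ^+ 2 + x = x * (x + 1)); last by ring.
  move=> /(vge_valE (mulf_neq0 n0 n1')); rewrite (v_mul hk) // => h.
  have [h1|h1] := leP 1 (v x); first by left; right.
  right; rewrite (_ : x - 1 = (x + 1) - 2 * 1); last by ring.
  apply: (vgeB hk); [right; lia | apply: two1; right; by rewrite (v_one hk)].
pose f i := red (p (lift i)).
pose A := [set f i | i in [set: S]].
have one0 : vge 0 1 by right; rewrite (v_one hk).
(* Two residues with the same image under [p] differ by 0 or 1, so the image [A] has at least half
   as many elements as the field. *)
have fib a : (#|[set i | f i == a]| <= 2)%N.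
  case: (pickP (fun i => f i == a)) => [i /eqP fi|no]; last first.
    by rewrite (_ : [set _ | _] = set0) ?cards0 //; apply/setP => i; rewrite !inE no.
  have sub : [set j | f j == a] \subset [set i; red (lift i - 1)].
    apply/subsetP => j; rewrite !inE => /eqP; rewrite -fi => /redE.
    move=> /(_ (p0 _ (lift0 j)) (p0 _ (lift0 i))) h.
    have /p_ker : vge 0 (lift i - lift j) by exact: (vgeB hk).
    case.
    - rewrite -[X in vge _ X](subrK (p (lift i) - p (lift j))).
      apply: (vgeD hk); first exact: p_add.
      by rewrite -opprB; exact: (vgeN hk).
    - by move=> /redE h1; rewrite -(liftK i) -(liftK j) h1 ?eqxx.
    move=> h1; apply/orP; right; rewrite -(liftK j); apply/eqP/redE => //; first exact: (vgeB hk).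
    by rewrite (_ : _ - _ = - (lift i - lift j - 1)); [exact: (vgeN hk) | ring].
  apply: leq_trans (subset_leq_card sub) _; rewrite cards2; by case: eqP.
have cardA : (#|S| <= #|A| * 2)%N.
  rewrite -cardsT -sum1_card (partition_big_imset f) /= -sum_nat_const.
  apply: leq_sum => a _; apply: leq_trans (fib a); rewrite sum1dep_card.
  by apply: eq_leq; apply: eq_card => i; rewrite !inE.
have memA y : vge 0 y -> red y \in A -> exists x, vge 0 x /\ vge 1 (p x - y).
  move=> y0 /imsetP [i _ h]; exists (lift i); split=> //.
  by apply/redE => //; exact: p0.
have [rA|rA] := boolP (red r \in A).
  by have [x [x0 h]] := memA _ r0 rA; exists x; split=> //; constructor 1.
(* If [r] is not in the image, the translate of [A] by [r] is disjoint from [A]; by the count the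
   two cover the residue field. *)
pose B := [set red (r + lift i) | i in A].
have cardB : #|B| = #|A|.
  apply: card_in_imset => i j _ _ /redE => /(_ (vgeD hk r0 (lift0 i)) (vgeD hk r0 (lift0 j))).
  rewrite opprD addrACA subrr add0r => h.
  by rewrite -(liftK i) -(liftK j); apply/redE.
have disj : A :&: B = set0.
  apply/setP => a; rewrite !inE; apply/negP => /andP[/imsetP[i _ ->] /imsetP[b]].
  move=> /imsetP[j _ ->] h; case/negP: rA.
  have q0 : vge 0 (lift i - lift j) by exact: (vgeB hk).
  apply/imsetP; exists (red (lift i - lift j)) => //; apply/redE => //; first exact: p0.
  set w := lift (red (lift i - lift j)).
  have w00 : vge 0 w by exact: lift0.
  have w0 : vge 1 (w - (lift i - lift j)) by apply/redE => //; rewrite /w liftK.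
  set u := lift (f j).
  have u00 : vge 0 u by exact: lift0.
  have u0 : vge 1 (u - p (lift j)) by apply/redE => //; [exact: p0 | rewrite /u liftK].
  have h' : vge 1 (p (lift i) - (r + u)).
    by apply/redE; [exact: p0 | exact: (vgeD hk) | rewrite -h].
  rewrite (_ : r - p w = (p (lift i - lift j) - p w) - (p (lift i) - (r + u)) - (u - p (lift j))
     - (p (lift i - lift j) - (p (lift i) - p (lift j))) - 2 * 0); last by ring.
  apply: (vgeB hk); last by apply: two1; left.
  apply: (vgeB hk); last exact: p_add.
  apply: (vgeB hk) => //; apply: (vgeB hk) => //.
  rewrite (_ : _ - _ = - ((w - (lift i - lift j)) * (w + (lift i - lift j) + 1))); last by rewrite /p; ring.
  apply: (vgeN hk); apply: (vge_mul hk (m := 1) (n := 0)) => //.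
  by do 2![apply: (vgeD hk) => //].
have cover : A :|: B = [set: S].
  apply/eqP; rewrite eqEcard subsetT /= cardsU disj cards0 subn0 cardB cardsT.
  by rewrite addnn -muln2.
have : red r' \in A :|: B by rewrite cover inE.
rewrite inE => /orP[r'A|/imsetP[a /imsetP[i _ ->] h]].
  by have [x [x0 h]] := memA _ r0' r'A; exists x; split=> //; constructor 2.
exists (lift i); split=> //; constructor 3.
have u0 : vge 1 (lift (f i) - p (lift i)) by apply/redE; rewrite ?liftK //; exact: p0.
have h' : vge 1 (r' - (r + lift (f i))) by apply/redE => //; exact: (vgeD hk).
rewrite (_ : _ - _ = - (r' - (r + lift (f i))) - (lift (f i) - p (lift i)) - 2 * r); last first.
  by rewrite /p; ring.
apply: (vgeB hk); last exact: two1.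
by apply: (vgeB hk) => //; exact: (vgeN hk).
Qed.

End ResidueField.

(** * Norm groups of quadratic extensions *)

Section UnitFiltration.
Variables (k : fieldType) (v : k -> int) (hk : dyadic_local_field v).
Local Notation vge := (vge v).
Variable G : k -> Prop.
Hypothesis G_neq0 : forall x, G x -> x != 0.
Hypothesis G_mul : forall x y, G x -> G y -> G (x * y).
Hypothesis G_sqr : forall x, x != 0 -> G (x ^+ 2).

Definition unit_full (n : int) := forall u, vge n (u - 1) -> G u.

(** Index at most 2 of [G] in the group U_n of units with [vge n (u - 1)], phrased without quotient
    groups. *)
Definition unit_half (n : int) := forall u u', vge n (u - 1) -> vge n (u' - 1) ->
  [\/ G u, G u' | G (u * u')].

(** The elements of [G] in U_n map onto the graded piece U_n / U_{n+1}. *)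
Definition unit_approx (n : int) := forall u, vge n (u - 1) ->
  exists g, [/\ G g, vge n (g - 1) & vge (n + 1) (u - g)].

Lemma quot_step n u g : 0 < n -> vge n (g - 1) -> vge (n + 1) (u - g) ->
  vge (n + 1) (u / g - 1).
Proof.
move=> n0 /(unit_perturb hk n0) [g0 vg] h.
rewrite (_ : u / g - 1 = (u - g) / g); last by rewrite mulrBl divff.
by apply: vge_le (vge_div hk g0 h); rewrite vg; lia.
Qed.

Lemma unit_full_step n : 0 < n -> unit_approx n -> unit_full (n + 1) -> unit_full n.
Proof.
move=> n0 ap full u hu; have [g [Gg g1 ug]] := ap _ hu.
rewrite -[u](divfK (G_neq0 Gg)); apply: G_mul => //; apply: full.
exact: quot_step ug.
Qed.

Lemma unit_half_step n : 0 < n -> unit_approx n -> unit_half (n + 1) -> unit_half n.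
Proof.
move=> n0 ap half u u' hu hu'.
have [g [Gg g1 ug]] := ap _ hu; have [g' [Gg' g1' ug']] := ap _ hu'.
have [h|h|h] := half _ _ (quot_step n0 g1 ug) (quot_step n0 g1' ug').
- by constructor 1; rewrite -[u](divfK (G_neq0 Gg)); apply: G_mul.
- by constructor 2; rewrite -[u'](divfK (G_neq0 Gg')); apply: G_mul.
- constructor 3; rewrite -[u](divfK (G_neq0 Gg)) -[u'](divfK (G_neq0 Gg')) mulrACA.
  by apply: G_mul => //; apply: G_mul.
Qed.

Lemma unit_full_down (m : nat) n : 0 < n ->
  (forall i, n <= i -> i < n + m%:Z -> unit_approx i) -> unit_full (n + m%:Z) -> unit_full n.
Proof.
elim: m n => [|m IH] n n0 ap; first by rewrite addr0.
move=> full; apply: unit_full_step => //; first by apply: ap; lia.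
apply: IH; first lia.
  by move=> i h1 h2; apply: ap; lia.
by rewrite (_ : n + 1 + m%:Z = n + m.+1%:Z) //; lia.
Qed.

Lemma unit_half_down (m : nat) n : 0 < n ->
  (forall i, n <= i -> i < n + m%:Z -> unit_approx i) -> unit_half (n + m%:Z) -> unit_half n.
Proof.
elim: m n => [|m IH] n n0 ap; first by rewrite addr0.
move=> half; apply: unit_half_step => //; first by apply: ap; lia.
apply: IH; first lia.
  by move=> i h1 h2; apply: ap; lia.
by rewrite (_ : n + 1 + m%:Z = n + m.+1%:Z) //; lia.
Qed.

(** The exceptional level: the elements [1 + c * (x ^+ 2 + x)] of [G] reach the Artin-Schreier image
    in U_n / U_{n+1}, of index 2 by [residue_artin_schreier], and U_{n+1} is already contained in
    [G]. *)
Lemma unit_half_of_full n c : 0 < n -> c != 0 -> v c = n ->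
  (forall x, vge 0 x -> 1 + c * (x ^+ 2 + x) != 0 -> G (1 + c * (x ^+ 2 + x))) ->
  unit_full (n + 1) -> unit_half n.
Proof.
move=> n0 c0 vc Gc full u u' hu hu'.
have key w x : vge 0 x -> vge 0 ((w - 1) / c) ->
    vge 1 (x ^+ 2 + x - (w - 1) / c) -> G w.
  move=> x0 hw h; set g := 1 + c * (x ^+ 2 + x).
  have g1 : vge n (g - 1).
    rewrite /g addrAC subrr add0r; apply: (vge_mul hk (m := n) (n := 0)); first lia.
      by right; rewrite vc.
    by apply: (vgeD hk) => //; exact: (vge_sqr hk x0).
  have [gn0 _] := unit_perturb hk n0 g1.
  have Gg : G g by exact: Gc.
  rewrite -[w](divfK gn0); apply: G_mul => //; apply: full; apply: quot_step => //.
  rewrite (_ : w - g = - (c * (x ^+ 2 + x - (w - 1) / c))); last first.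
    by rewrite /g mulrBr [c * (_ / _)]mulrC divfK //; ring.
  by apply: (vgeN hk); apply: (vge_mul hk (m := n) (n := 1)) => //; right; rewrite vc.
have small w : vge n (w - 1) -> vge 0 ((w - 1) / c).
  by move=> h; apply: vge_le (vge_div hk c0 h); lia.
have [x [x0 h]] := residue_artin_schreier hk (small _ hu) (small _ hu').
case: h => h.
- by constructor 1; apply: (key u x) => //; exact: small.
- by constructor 2; apply: (key u' x) => //; exact: small.
(* On U_n / U_{n+1} multiplication becomes addition of residues: the cross term has valuation at
   least [n], which is positive. *)
have e : (u * u' - 1) / c = (u - 1) / c + (u' - 1) / c + ((u - 1) * (u' - 1)) / c.
  by rewrite -!mulrDl; congr (_ / _); ring.
have s : vge 1 ((u - 1) * (u' - 1) / c).
  by apply: vge_le (vge_div hk c0 (vgeM hk hu hu')); lia.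
constructor 3; apply: (key _ x) => //.
  rewrite e; apply: (vgeD hk); last by apply: vge_le s.
  by apply: (vgeD hk); exact: small.
by rewrite e opprD addrA; apply: (vgeB hk).
Qed.

(** In [(1 + q * y) ^+ 2] with [v q = j], the cross term has valuation at least [v 2 + j], beyond
    [2 * j], so squares fill the even levels below [2 * v 2]. *)
Lemma unit_approx_sqr n j : n = j + j -> 0 < j -> j < v 2 -> unit_approx n.
Proof.
move=> -> j0 j2 u hu; have [q [q0 vq]] := exists_val hk j.
have [|y [y0 hy]] := @residue_sqrt _ _ hk ((u - 1) / q ^+ 2).
  by apply: vge_le (vge_div hk (expf_neq0 2 q0) hu); rewrite (v_sqr hk) // vq; lia.
have s : vge (j + j + 1) (u - (1 + q * y) ^+ 2).
  rewrite (_ : _ - _ = - (q ^+ 2 * (y ^+ 2 - (u - 1) / q ^+ 2)) - 2 * (q * y)); last first.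
    by rewrite mulrBr [q ^+ 2 * ((u - 1) / _)]mulrC divfK ?expf_neq0 //; ring.
  apply: (vgeB hk).
    apply: (vgeN hk); apply: (vge_mul hk (m := j + j) (n := 1)) => //.
    by right; rewrite (v_sqr hk) // vq.
  apply: (vge_mul hk (m := v 2) (n := j)); [lia | by right|].
  by apply: (vge_mul hk (m := j) (n := 0)) => //; [lia | right; rewrite vq].
have g1 : vge (j + j) ((1 + q * y) ^+ 2 - 1).
  rewrite (_ : _ - 1 = (u - 1) - (u - (1 + q * y) ^+ 2)); last by ring.
  by apply: (vgeB hk) => //; apply: vge_le s; lia.
exists ((1 + q * y) ^+ 2); split=> //; apply: G_sqr.
have jj : 0 < j + j by lia.
by have [] := unit_perturb hk jj g1; rewrite sqrf_eq0.
Qed.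

(** * Approximation of units by values of a norm form with constant term 1 *)

Section NormForm.
Variables T M : k.
Hypothesis G_form : forall y, 1 + T * y + M * y ^+ 2 != 0 -> G (1 + T * y + M * y ^+ 2).

Lemma unit_approx_form n u y : 0 < n -> vge n (u - 1) ->
  vge (n + 1) (u - (1 + T * y + M * y ^+ 2)) ->
  exists g, [/\ G g, vge n (g - 1) & vge (n + 1) (u - g)].
Proof.
move=> n0 hu s; set g := 1 + _ + _ in s.
have g1 : vge n (g - 1).
  rewrite (_ : g - 1 = (u - 1) - (u - g)); last by ring.
  by apply: (vgeB hk) => //; apply: vge_le s; lia.
by exists g; split=> //; apply: G_form; case: (unit_perturb hk n0 g1).
Qed.

(** High levels: the linear term dominates, and solving for it alone leaves the error [M * y ^+ 2]
    at level [n + 1]. *)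
Lemma unit_approx_lin n m : 0 < n -> T != 0 -> vge m M -> v T + v T + 1 <= n + m ->
  unit_approx n.
Proof.
move=> n0 T0 hM nm u hu; apply: (unit_approx_form (y := (u - 1) / T)) => //.
rewrite (_ : _ - _ = - (M * ((u - 1) / T) ^+ 2)); last first.
  by rewrite [T * _]mulrC divfK //; ring.
apply: (vgeN hk); apply: (vge_mul hk) hM (vge_sqr hk (vge_div hk T0 hu)); lia.
Qed.

(** Odd low levels: [M] is a uniformizer, so the quadratic term dominates and a residue square root
    gives [y]. *)
Lemma unit_approx_quad n j : M != 0 -> v M = 1 -> n = j + j + 1 -> 0 <= j ->
  vge (j + 2) T -> unit_approx n.
Proof.
move=> M0 vM -> j0 hT u hu; have [q [q0 vq]] := exists_val hk j.
have Mq0 : M * q ^+ 2 != 0 by rewrite mulf_neq0 ?expf_neq0.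
have vMq : v (M * q ^+ 2) = j + j + 1.
  by rewrite (v_mul hk) ?expf_neq0 // (v_sqr hk) // vq vM; lia.
have [|y [y0 hy]] := @residue_sqrt _ _ hk ((u - 1) / (M * q ^+ 2)).
  by apply: vge_le (vge_div hk Mq0 hu); rewrite vMq; lia.
apply: (unit_approx_form (y := q * y)) => //; first lia.
rewrite (_ : _ - _ = - (M * q ^+ 2 * (y ^+ 2 - (u - 1) / (M * q ^+ 2))) - T * (q * y)); last first.
  by rewrite mulrBr [_ * (_ / _)]mulrC divfK //; ring.
apply: (vgeB hk).
  by apply: (vgeN hk); apply: (vge_mul hk (m := j + j + 1) (n := 1)) => //; right; rewrite vMq.
apply: (vge_mul hk (m := j + 2) (n := j)) => //; first lia.
by apply: (vge_mul hk (m := j) (n := 0)) => //; [lia | right; rewrite vq].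
Qed.

End NormForm.

Lemma unit_full_deep : unit_full (v 2 + v 2 + 1).
Proof. by move=> u /(square_near1 hk) [w [w0 ->]]; exact: G_sqr. Qed.

Lemma even_val_unit c i : c != 0 -> v c = i + i ->
  exists u w, [/\ w != 0, c = u * w ^+ 2 & vge 1 (u - 1)].
Proof.
move=> c0 vc; have [q [q0 vq]] := exists_val hk i.
have q20 := expf_neq0 2 q0.
have vx : v (c / q ^+ 2) = 0 by rewrite (v_mul hk) ?invr_eq0 // (v_inv hk) // (v_sqr hk) // vq vc; lia.
have [|y [y0 hy]] := @residue_sqrt _ _ hk (c / q ^+ 2); first by right; rewrite vx.
have [n0 vy] : y ^+ 2 != 0 /\ v (y ^+ 2) = 0.
  have := @val_perturb _ _ hk (c / q ^+ 2) (y ^+ 2 - c / q ^+ 2).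
  rewrite [X in X != 0 /\ _]addrC subrK [_ + (_ - _)]addrC subrK vx; apply.
    by rewrite mulf_neq0 ?invr_eq0.
  by apply: vge_le hy; lia.
exists (c / q ^+ 2 / y ^+ 2), (y * q); split.
- by rewrite mulf_neq0 //; move: n0; rewrite sqrf_eq0.
- by rewrite exprMn mulrA divfK // divfK.
rewrite (_ : _ - 1 = - ((y ^+ 2 - c / q ^+ 2) / y ^+ 2)); last by rewrite mulrBl divff // opprB.
by apply: (vgeN hk); apply: vge_le (vge_div hk n0 hy); rewrite vy; lia.
Qed.

Lemma G_cancel_sqr x w : w != 0 -> G (x * w ^+ 2) -> G x.
Proof.
move=> w0 h; rewrite (_ : x = x * w ^+ 2 * (w^-1) ^+ 2); last first.
  by rewrite exprVn mulfK // expf_neq0.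
by apply: G_mul => //; apply: G_sqr; rewrite invr_eq0.
Qed.

(** Elements of even valuation are squares times units of U_1, hence in [G]; two elements of odd
    valuation have a product of even valuation. *)
Lemma index2_of_full : unit_full 1 -> forall c c', c != 0 -> c' != 0 ->
  [\/ G c, G c' | G (c * c')].
Proof.
move=> full c c' c0 c0'.
have ev x i : x != 0 -> v x = i + i -> G x.
  by move=> x0 /(even_val_unit x0) [u [w [w0 -> /full Gu]]]; apply: G_mul => //; exact: G_sqr.
have [|o] := boolP (2 %| v c)%Z; first by move=> /dvdzP[i hi]; constructor 1; apply: (ev _ i) => //; lia.
have [|o'] := boolP (2 %| v c')%Z; first by move=> /dvdzP[i hi]; constructor 2; apply: (ev _ i) => //; lia.
constructor 3; apply: (ev _ ((v c + v c') %/ 2)%Z); first by rewrite mulf_neq0.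
rewrite (v_mul hk) //; lia.
Qed.

(** The element [g] of odd valuation in [G] moves every element to even valuation, where the index
    is read on U_1. *)
Lemma index2_of_half g i : G g -> v g = i + i + 1 -> unit_half 1 ->
  forall c c', c != 0 -> c' != 0 -> [\/ G c, G c' | G (c * c')].
Proof.
move=> Gg vg half c c' c0 c0'; have g0 := G_neq0 Gg.
have red x : x != 0 -> exists u w h, [/\ w != 0, G h, x * h = u * w ^+ 2 & vge 1 (u - 1)].
  move=> x0; have [|o] := boolP (2 %| v x)%Z.
    move=> /dvdzP[j hj]; have [|u [w [w0 e hu]]] := @even_val_unit x j x0; first lia.
    by exists u, w, (1 ^+ 2); split=> //; [apply: G_sqr; exact: oner_neq0 | rewrite expr1n mulr1].
  have [||u [w [w0 e hu]]] := @even_val_unit (x * g) ((v x + v g) %/ 2)%Z; first by rewrite mulf_neq0.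
    by rewrite (v_mul hk) //; lia.
  by exists u, w, g.
have [u [w [h [w0 Gh e hu]]]] := red c c0.
have [u' [w' [h' [w0' Gh' e' hu']]]] := red c' c0'.
have back x h1 : G h1 -> G (x * h1) -> G x.
  move=> Gh1 Gx; apply: (@G_cancel_sqr x h1 (G_neq0 Gh1)).
  by rewrite expr2 mulrA; apply: G_mul.
have [Gu|Gu|Gu] := half _ _ hu hu'.
- by constructor 1; apply: (back _ h) => //; rewrite e; apply: G_mul => //; exact: G_sqr.
- by constructor 2; apply: (back _ h') => //; rewrite e'; apply: G_mul => //; exact: G_sqr.
constructor 3; apply: (back _ (h * h')); first exact: G_mul.
rewrite mulrACA e e' mulrACA -exprMn; apply: G_mul => //; apply: G_sqr.
by rewrite mulf_neq0.
Qed.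

End UnitFiltration.

(** * The norm group of a quadratic extension has index at most 2 *)

Section NormIndex.
Variables (k : fieldType) (v : k -> int) (hk : dyadic_local_field v).
Local Notation vge := (vge v).

(** The norm group of the algebra k[X]/(X^2 - d); for [d = - nrm c] with [c] a nonzero pure
    quaternion it is the norm group of k(c). *)
Definition binorm (d n : k) : Prop := n != 0 /\ exists x y, n = x ^+ 2 - d * y ^+ 2.

Lemma binorm_neq0 d n : binorm d n -> n != 0. Proof. by case. Qed.

Lemma binorm_mul d m n : binorm d m -> binorm d n -> binorm d (m * n).
Proof.
move=> [m0 [x [y hm]]] [n0 [z [t hn]]]; split; first by rewrite mulf_neq0.
by exists (x * z + d * y * t), (x * t + y * z); rewrite hm hn; ring.
Qed.

Lemma binorm_sqr d x : x != 0 -> binorm d (x ^+ 2).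
Proof. by move=> x0; split; [rewrite expf_neq0 | exists x, 0; ring]. Qed.

Lemma binorm_cancel_sqr d x w : w != 0 -> binorm d (x * w ^+ 2) -> binorm d x.
Proof. by apply: G_cancel_sqr; [exact: binorm_mul | exact: binorm_sqr]. Qed.

Lemma binorm_inv d x : binorm d x -> binorm d x^-1.
Proof.
move=> h; have x0 := binorm_neq0 h; apply: (binorm_cancel_sqr x0).
by rewrite expr2 mulrA mulVf // mul1r.
Qed.

Lemma binorm_div d x y : binorm d y -> binorm d (x * y) -> binorm d x.
Proof.
move=> hy h; rewrite -[x](mulfK (binorm_neq0 hy)).
exact: binorm_mul h (binorm_inv hy).
Qed.

(** The quadratic defect. As long as the error [c] has even valuation below [2 * v 2], dividing by
    an approximating square pushes it deeper; the process stops at an odd valuation or at 4 times an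
    integer. *)
Lemma sqr_defect (d : k) : d != 0 -> (2 %| v d)%Z ->
  exists w c, [/\ w != 0, d * w ^+ 2 = 1 + c &
    vge (v 2 + v 2) c \/ exists j, [/\ 0 <= j, v c = j + j + 1, c != 0 & j < v 2]].
Proof.
move=> d0 /dvdzP[i vd]; have e0 := dlf_dyadic hk.
have main (m : nat) : m.+1%:Z <= v 2 + v 2 -> exists w c, [/\ w != 0, d * w ^+ 2 = 1 + c &
    vge m.+1%:Z c \/ exists j, [/\ 0 <= j, v c = j + j + 1, c != 0 & j < v 2]].
  elim: m => [|m IH] hm.
    have [|u [w [w0 e hu]]] := @even_val_unit _ _ hk d i d0; first lia.
    exists w^-1, (u - 1); split; [by rewrite invr_eq0 | | by left].
    by rewrite e -mulrA -exprMn divff // expr1n mulr1; ring.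
  have [|w [c [w0 e h]]] := IH; first lia.
  case: h => [hc|h]; last by exists w, c; split=> //; right.
  have [c0|c0] := eqVneq c 0; first by exists w, c; split=> //; left; left.
  have [lt|ge] := ltP m.+1%:Z (v c).
    by exists w, c; split=> //; left; right; lia.
  have vc : v c = m.+1%:Z by have := vge_valE c0 hc; lia.
  have [/dvdzP[j hj]|o] := boolP (2 %| v c)%Z; last first.
    exists w, c; split=> //; right; exists (v c %/ 2)%Z; split=> //; lia.
  have [|||g [[z [z0 ->]] g1 hg]] := @unit_approx_sqr _ _ hk (fun x => exists z, z != 0 /\ x = z ^+ 2)
    (fun x x0 => ex_intro _ x (conj x0 erefl)) (j + j) j erefl _ _ (1 + c); try lia.
    by rewrite addrAC subrr add0r; apply: vge_le hc; lia.
  exists (w / z), ((1 + c) / z ^+ 2 - 1); split.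
  - by rewrite mulf_neq0 ?invr_eq0.
  - by rewrite exprMn exprVn mulrA e; ring.
  left; apply: vge_le (quot_step hk _ g1 hg); lia.
have [|w [c [w0 e h]]] := main (absz (v 2 + v 2)%R).-1; first lia.
exists w, c; split=> //; case: h => [h|]; [left; apply: vge_le h; lia | by right].
Qed.

Theorem binorm_index2 (d c c' : k) : d != 0 -> c != 0 -> c' != 0 ->
  [\/ binorm d c, binorm d c' | binorm d (c * c')].
Proof.
move=> d0; have e0 := dlf_dyadic hk; have t0 := two_neq0 hk.
have Gn := @binorm_neq0 d; have Gm := @binorm_mul d; have Gs := @binorm_sqr d.
have [ev|odd] := boolP (2 %| v d)%Z; last first.
  have [q [q0 vq]] := exists_val hk (- (v d %/ 2)%Z).
  (* Odd valuation of [d]. The multiplier [q] makes [M] a uniformizer, and [M] is itself a norm. *)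
  pose M := - d * q ^+ 2.
  have M0 : M != 0 by rewrite mulf_neq0 ?oppr_eq0 ?expf_neq0.
  have vM : v M = 1 by rewrite (v_mul hk) ?oppr_eq0 ?expf_neq0 // (v_sqr hk) // (v_opp hk) vq; lia.
  have GM : binorm d M by split=> //; exists 0, q; rewrite /M; ring.
  apply: (@index2_of_half _ _ hk _ Gn Gm Gs M 0 GM); first by rewrite vM.
  have form y : 1 + 0 * y + M * y ^+ 2 != 0 -> binorm d (1 + 0 * y + M * y ^+ 2).
    by move=> h; split=> //; exists 1, (q * y); rewrite /M; ring.
  apply: (unit_half_down (m := absz (v 2 + v 2 - 1)%R) hk Gn Gm) => //.
    move=> i i1 i2; have [/dvdzP[j hj]|o] := boolP (2 %| i)%Z.
      apply: (unit_approx_sqr hk Gs (j := j)); lia.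
    apply: (unit_approx_quad hk form (j := (i %/ 2)%Z)) => //; [lia|lia|by left].
  (* The exceptional level is [2 * v 2], where the values [1 + 4 * (x ^+ 2 + x)] are squares. *)
  rewrite (_ : 1 + _ = v 2 + v 2); last lia.
  apply: (unit_half_of_full hk Gm (c := 2 ^+ 2)); first lia.
  - by rewrite expf_neq0.
  - by rewrite (v_sqr hk).
  - move=> x _; have -> : 1 + 2 ^+ 2 * (x ^+ 2 + x) = (1 + 2 * x) ^+ 2 by ring.
    by rewrite sqrf_eq0; exact: Gs.
  exact: (unit_full_deep hk Gs).
have [w [e [w0 dw he]]] := sqr_defect d0 ev.
case: he => [he|[m [m0 ve en0 m2]]].
  apply: (index2_of_full hk Gm Gs).
  (* Defect in 4O. As [d * w ^+ 2 = 1 + e], the norm of [1 + (1 + w sqrt d) y / 2] is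
     [1 + y - (e / 4) y ^+ 2]; the coefficients are integral, and the linear term serves every
     level, so all of U_1 consists of norms. *)
  have form y : 1 + 1 * y + (- e / 2 ^+ 2) * y ^+ 2 != 0 ->
      binorm d (1 + 1 * y + (- e / 2 ^+ 2) * y ^+ 2).
    move=> h; split=> //; exists (1 + y / 2), (w * (y / 2)).
    by rewrite exprMn [d * _]mulrA dw; field; rewrite t0; apply/eqP; exact: (dlf_char0 hk (n := 3%N)).
  apply: (unit_full_down (m := absz (v 2 + v 2)%R) hk Gn Gm) => //; last first.
    by rewrite (_ : 1 + _ = v 2 + v 2 + 1); [exact: (unit_full_deep hk Gs) | lia].
  move=> i i1 i2; apply: (unit_approx_lin hk form (m := 0)); [lia|exact: oner_neq0| |].
    by apply: vge_le (vge_div hk (expf_neq0 2 t0) (vgeN hk he)); rewrite (v_sqr hk) //; lia.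
  by rewrite (v_one hk); lia.
have [q [q0 vq]] := exists_val hk m.
have q20 := expf_neq0 2 q0.
(* Defect of odd valuation. The form is the norm of [1 + (1 + w sqrt d) y / q], with [q] chosen so
   that [M] has valuation 1. *)
pose T := 2 / q; pose M := - e / q ^+ 2.
have T0 : T != 0 by rewrite mulf_neq0 ?invr_eq0.
have M0 : M != 0 by rewrite mulf_neq0 ?oppr_eq0 ?invr_eq0.
have vT : v T = v 2 - m by rewrite (v_mul hk) ?invr_eq0 // (v_inv hk) // vq.
have vM : v M = 1.
  by rewrite (v_mul hk) ?oppr_eq0 ?invr_eq0 // (v_opp hk) (v_inv hk) // (v_sqr hk) // vq ve; lia.
have form y : 1 + T * y + M * y ^+ 2 != 0 -> binorm d (1 + T * y + M * y ^+ 2).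
  move=> h; split=> //; exists (1 + y / q), (w * (y / q)).
  by rewrite exprMn [d * _]mulrA dw /T /M; field.
have Ge : binorm d (- e).
  by split; [rewrite oppr_eq0 | exists 1, w; rewrite dw; ring].
apply: (index2_of_half (g := - e) (i := m) hk Gn Gm Gs) => //; first by rewrite (v_opp hk).
apply: (unit_half_down (m := absz (v T + v T - 2)%R) hk Gn Gm) => //.
  move=> i i1 i2; have [/dvdzP[j hj]|o] := boolP (2 %| i)%Z.
    apply: (unit_approx_sqr hk Gs (j := j)); lia.
  apply: (unit_approx_quad hk form (j := (i %/ 2)%Z)) => //; [lia|lia|by right; lia].
rewrite (_ : 1 + _ = v T + v T - 1); last lia.
(* At level [2 * v T - 1] the linear and quadratic terms have equal weight; [y = (T / M) * x] turns
   the form into [1 + (T ^+ 2 / M) * (x ^+ 2 + x)]. *)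
apply: (unit_half_of_full hk Gm (c := T ^+ 2 / M)); first lia.
- by rewrite mulf_neq0 ?invr_eq0 ?expf_neq0.
- by rewrite (v_mul hk) ?invr_eq0 ?expf_neq0 // (v_inv hk) // (v_sqr hk) // vM.
- move=> x _.
  have -> : 1 + T ^+ 2 / M * (x ^+ 2 + x) = 1 + T * (T / M * x) + M * (T / M * x) ^+ 2.
    by field.
  exact: form.
(* Above the exceptional level the linear term wins, down from the level where all units are
   squares. *)
rewrite subrK; apply: (unit_full_down (m := absz (v 2 + v 2 + 1 - (v T + v T))%R) hk Gn Gm); first lia.
  move=> i i1 i2; apply: (unit_approx_lin hk form (m := 1)) => //; [lia|by right; rewrite vM|lia].
by rewrite (_ : v T + v T + _ = v 2 + v 2 + 1); [exact: (unit_full_deep hk Gs) | lia].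
Qed.

End NormIndex.

(** * The quaternion algebra *)

(** The alias records [a] and [b], on which the multiplication depends, so that the ring structure
    can be attached to the type. *)
Definition quatalg (k : fieldType) (a b : k) := quat k.

Section QuaternionRing.
Variables (k : fieldType) (a b : k).
Local Notation D := (quatalg a b).

Definition quat_to_tuple (x : D) : k * k * k * k := (q0 x, q1 x, q2 x, q3 x).
Definition quat_of_tuple (x : k * k * k * k) : D := Quat x.1.1.1 x.1.1.2 x.1.2 x.2.
Lemma quat_to_tupleK : cancel quat_to_tuple quat_of_tuple. Proof. by case. Qed.

HB.instance Definition _ := Choice.copy D (can_type quat_to_tupleK).

Fact quat_addA : associative (@qadd k : D -> D -> D).
Proof. by case=> ? ? ? ? [? ? ? ?] [? ? ? ?]; congr Quat; rewrite /= addrA. Qed.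
Fact quat_addC : commutative (@qadd k : D -> D -> D).
Proof. by case=> ? ? ? ? [? ? ? ?]; congr Quat; rewrite /= addrC. Qed.
Fact quat_add0 : left_id (qzero k : D) (@qadd k : D -> D -> D).
Proof. by case=> ? ? ? ?; congr Quat; rewrite /= add0r. Qed.
Fact quat_addN : left_inverse (qzero k : D) (@qopp k : D -> D) (@qadd k : D -> D -> D).
Proof. by case=> ? ? ? ?; congr Quat; rewrite /= addNr. Qed.
HB.instance Definition _ := GRing.isZmodule.Build D quat_addA quat_addC quat_add0 quat_addN.

Fact quat_mulA : associative (qmul a b : D -> D -> D).
Proof. by case=> ? ? ? ? [? ? ? ?] [? ? ? ?]; congr Quat => /=; ring. Qed.
Fact quat_mul1l : left_id (qone k : D) (qmul a b : D -> D -> D).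
Proof. by case=> ? ? ? ?; congr Quat => /=; ring. Qed.
Fact quat_mul1r : right_id (qone k : D) (qmul a b : D -> D -> D).
Proof. by case=> ? ? ? ?; congr Quat => /=; ring. Qed.
Fact quat_mulDl : left_distributive (qmul a b : D -> D -> D) +%R.
Proof. by case=> ? ? ? ? [? ? ? ?] [? ? ? ?]; congr Quat => /=; ring. Qed.
Fact quat_mulDr : right_distributive (qmul a b : D -> D -> D) +%R.
Proof. by case=> ? ? ? ? [? ? ? ?] [? ? ? ?]; congr Quat => /=; ring. Qed.
Fact quat_one_neq0 : (qone k : D) != 0.
Proof. by apply/eqP => -[/eqP]; rewrite oner_eq0. Qed.
HB.instance Definition _ := GRing.Zmodule_isNzRing.Build D
  quat_mulA quat_mul1l quat_mul1r quat_mulDl quat_mulDr quat_one_neq0.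

Definition quat_scale (c : k) (x : D) : D := Quat (c * q0 x) (c * q1 x) (c * q2 x) (c * q3 x).
Fact quat_scaleA c d x : quat_scale c (quat_scale d x) = quat_scale (c * d) x.
Proof. by case: x => ? ? ? ?; congr Quat; rewrite /= mulrA. Qed.
Fact quat_scale1 : left_id 1 quat_scale.
Proof. by case=> ? ? ? ?; congr Quat; rewrite /= mul1r. Qed.
Fact quat_scaleDr : right_distributive quat_scale +%R.
Proof. by move=> c [? ? ? ?] [? ? ? ?]; congr Quat; rewrite /= mulrDr. Qed.
Fact quat_scaleDl x : {morph quat_scale^~ x : c d / c + d}.
Proof. by case: x => ? ? ? ? c d; congr Quat; rewrite /= mulrDl. Qed.
HB.instance Definition _ := GRing.Zmodule_isLmodule.Build k D
  quat_scaleA quat_scale1 quat_scaleDr quat_scaleDl.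

Fact quat_scaleAl (c : k) (x y : D) : c *: (x * y) = (c *: x) * y.
Proof. by case: x y => ? ? ? ? [? ? ? ?]; congr Quat => /=; ring. Qed.
HB.instance Definition _ := GRing.Lmodule_isLalgebra.Build k D quat_scaleAl.
Fact quat_scaleAr (c : k) (x y : D) : c *: (x * y) = x * (c *: y).
Proof. by case: x y => ? ? ? ? [? ? ? ?]; congr Quat => /=; ring. Qed.
HB.instance Definition _ := GRing.Lalgebra_isAlgebra.Build k D quat_scaleAr.

End QuaternionRing.

(** * Conjugation, reduced norm and trace *)

Section QuaternionNorm.
Variables (k : fieldType) (a b : k).
Local Notation D := (quatalg a b).

Definition qbar (x : D) : D := qconj x.
Definition nrm (x : D) : k := qnorm a b x.
Definition qtr (x : D) : k := 2 * q0 x.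
Definition qiv (x : D) : D := qinv a b x.

Lemma qbarD x y : qbar (x + y) = qbar x + qbar y.
Proof. by case: x y => ? ? ? ? [? ? ? ?]; congr Quat => /=; ring. Qed.
Lemma qbarN x : qbar (- x) = - qbar x. Proof. by []. Qed.
Lemma qbarB x y : qbar (x - y) = qbar x - qbar y. Proof. by rewrite qbarD qbarN. Qed.
Lemma qbarM x y : qbar (x * y) = qbar y * qbar x.
Proof. by case: x y => ? ? ? ? [? ? ? ?]; congr Quat => /=; ring. Qed.
Lemma qbarZ c x : qbar (c *: x) = c *: qbar x.
Proof. by case: x => ? ? ? ?; congr Quat => /=; ring. Qed.
Lemma qbarK x : qbar (qbar x) = x.
Proof. by case: x => ? ? ? ?; congr Quat => /=; ring. Qed.
Lemma qbar1 : qbar 1 = 1. Proof. by congr Quat => /=; ring. Qed.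
Lemma qbar0 : qbar 0 = 0. Proof. by congr Quat => /=; ring. Qed.

Lemma qscalE (c : k) : qscal c = c%:A :> D. Proof. by congr Quat => /=; ring. Qed.

Lemma qmul_qbar x : x * qbar x = (nrm x)%:A.
Proof. by case: x => ? ? ? ?; rewrite -qscalE; congr Quat; rewrite /= /nrm /qnorm /=; ring. Qed.
Lemma qbar_mul x : qbar x * x = (nrm x)%:A.
Proof. by case: x => ? ? ? ?; rewrite -qscalE; congr Quat; rewrite /= /nrm /qnorm /=; ring. Qed.
Lemma nrmM x y : nrm (x * y) = nrm x * nrm y.
Proof. by case: x y => ? ? ? ? [? ? ? ?]; rewrite /nrm /qnorm /=; ring. Qed.
Lemma nrmZ c x : nrm (c *: x) = c ^+ 2 * nrm x.
Proof. by case: x => ? ? ? ?; rewrite /nrm /qnorm /=; ring. Qed.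
Lemma nrmN x : nrm (- x) = nrm x.
Proof. by case: x => ? ? ? ?; rewrite /nrm /qnorm /=; ring. Qed.
Lemma nrmC x : nrm (qbar x) = nrm x.
Proof. by case: x => ? ? ? ?; rewrite /nrm /qnorm /=; ring. Qed.
Lemma nrm1 : nrm 1 = 1. Proof. by rewrite /nrm /qnorm /=; ring. Qed.
Lemma nrm0 : nrm 0 = 0. Proof. by rewrite /nrm /qnorm /=; ring. Qed.
Lemma nrmD1 x : nrm (1 + x) = 1 + qtr x + nrm x.
Proof. by case: x => ? ? ? ?; rewrite /nrm /qtr /qnorm /=; ring. Qed.
Lemma nrm_sub_alg (c : k) x : nrm (2 *: x - c%:A) = 4 * nrm x - 2 * c * qtr x + c ^+ 2.
Proof. by case: x => ? ? ? ?; rewrite -qscalE /nrm /qtr /qnorm /=; ring. Qed.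
Lemma cayley x : x * x = qtr x *: x - (nrm x)%:A.
Proof. by case: x => ? ? ? ?; rewrite -qscalE; congr Quat; rewrite /= /nrm /qtr /qnorm /=; ring. Qed.
Lemma qivE x : qiv x = (nrm x)^-1 *: qbar x.
Proof. by case: x => ? ? ? ?; congr Quat; rewrite /= /nrm; ring. Qed.
Lemma nrmV x : nrm (qiv x) = (nrm x)^-1.
Proof.
rewrite qivE nrmZ nrmC; have [->|n0] := eqVneq (nrm x) 0; first by rewrite mulr0 invr0.
by rewrite expr2 mulfVK.
Qed.
Lemma qbarV x : qbar (qiv x) = qiv (qbar x).
Proof. by rewrite !qivE qbarZ nrmC. Qed.
Lemma pure_qbar (x : D) : pure x -> qbar x = - x.
Proof. by case: x => ? ? ? ?; rewrite /pure /= => ->; congr Quat => /=; ring. Qed.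
Lemma pure_sqr (x : D) : pure x -> x * x = - (nrm x)%:A.
Proof. by move=> h; rewrite -qmul_qbar pure_qbar // mulrN opprK. Qed.
Hypothesis two0 : (2 : k) != 0.

Lemma qbar_pure x : qbar x = - x -> pure x.
Proof.
case: x => x ? ? ? [h]; rewrite /pure /=.
by apply/eqP; rewrite -(mulrI_eq0 _ (mulfI two0)) mulr_natl mulr2n {1}h addNr.
Qed.

Lemma qbar_fixed x : qbar x = x -> x = (q0 x)%:A.
Proof.
have z (y : k) : - y = y -> y = 0.
  by move=> h; apply/eqP; rewrite -(mulrI_eq0 _ (mulfI two0)) mulr_natl mulr2n -{1}h addNr.
by case: x => x x1 x2 x3 [/= /z -> /z -> /z ->]; rewrite -qscalE.
Qed.

Lemma nrm_fixed x : qbar x = x -> nrm x = q0 x ^+ 2.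
Proof. by move=> /qbar_fixed {1}->; rewrite nrmZ nrm1 mulr1. Qed.

End QuaternionNorm.

(** * The valuation of the division algebra *)

Section QuaternionDivision.
Variables (k : fieldType) (v : k -> int) (hk : dyadic_local_field v).
Variables (a b : k) (hD : quat_division a b).
Local Notation D := (quatalg a b).
Local Notation vge := (vge v).
Implicit Types x y z r : D.

Lemma nrm_eq0 x : (nrm x == 0) = (x == 0).
Proof.
apply/idP/idP => [/eqP n0|/eqP ->]; last by rewrite nrm0.
apply/eqP; apply: contrapT => /(proj2 (proj2 hD) x) [y xy].
have := nrmM x y; rewrite n0 mul0r (_ : x * y = 1) // nrm1 => /eqP.
by rewrite oner_eq0.
Qed.

Lemma qmulV x : x != 0 -> x * qiv x = 1.
Proof. by rewrite -nrm_eq0 => n0; rewrite qivE -scalerAr qmul_qbar scalerA mulVf // scale1r. Qed.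

Lemma qVmul x : x != 0 -> qiv x * x = 1.
Proof. by rewrite -nrm_eq0 => n0; rewrite qivE -scalerAl qbar_mul scalerA mulVf // scale1r. Qed.

Lemma qbar_neq0 x : x != 0 -> qbar x != 0.
Proof. by rewrite -!nrm_eq0 nrmC. Qed.

Lemma qmul_neq0 x y : x != 0 -> y != 0 -> x * y != 0.
Proof. by rewrite -!nrm_eq0 nrmM; exact: mulf_neq0. Qed.

Lemma qmulI x y z : x != 0 -> x * y = x * z -> y = z.
Proof. by move=> x0 /(congr1 ( *%R (qiv x))); rewrite !mulrA qVmul // !mul1r. Qed.

Lemma qmulIr x y z : x != 0 -> y * x = z * x -> y = z.
Proof. by move=> x0 /(congr1 ( *%R^~ (qiv x))); rewrite -!mulrA qmulV // !mulr1. Qed.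

Lemma double_eq0 x : x + x = 0 -> x = 0.
Proof.
rewrite -mulr2n -scaler_nat => /(congr1 ( *:%R 2^-1)).
by rewrite scalerA mulVf ?scale1r ?scaler0 ?(two_neq0 hk).
Qed.

(** If the trace T had negative valuation, T^2 - 4N would be a square by [square_near1], so the
    characteristic polynomial would split and [x] would be a scalar, as the norm is anisotropic. A
    scalar of integral norm is integral, and so is its trace. *)
Lemma qtr_integral x : vge 0 (nrm x) -> vge 0 (qtr x).
Proof.
move=> hx; have t0 := two_neq0 hk; have e0 := dlf_dyadic hk.
have [T0|T0] := eqVneq (qtr x) 0; first by left.
have [//|lt] := leP 0 (v (qtr x)); first by right.
have [T eT] : exists T, T = qtr x by exists (qtr x).
rewrite -eT in T0 lt *.
have [|w [w0 hw]] := @square_near1 _ _ hk (1 - 2 ^+ 2 * nrm x / T ^+ 2).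
  rewrite [1 - _ - 1]addrAC subrr add0r -mulrA; apply: (vgeN hk).
  apply: (vge_mul hk (m := v 2 + v 2) (n := 1)); first lia.
    by right; rewrite (v_sqr hk).
  by apply: vge_le (vge_div hk (expf_neq0 2 T0) hx); rewrite (v_sqr hk) //; lia.
have /eqP : nrm (2 *: x - (T + w * T)%:A) = 0.
  have e : T ^+ 2 - (w * T) ^+ 2 = 2 ^+ 2 * nrm x.
    by rewrite exprMn -hw mulrBl mul1r divfK ?expf_neq0 //; ring.
  rewrite nrm_sub_alg -eT (_ : 4 * nrm x = T ^+ 2 - (w * T) ^+ 2); first by ring.
  by rewrite e; ring.
rewrite nrm_eq0 subr_eq0 => /eqP hx2.
pose c := (T + w * T) / 2.
have ex : x = c%:A.
  by rewrite -[x](scalerK t0) hx2 scalerA mulrC.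
have {}eT : T = 2 * c by rewrite eT ex -qscalE.
move: hx; rewrite ex nrmZ nrm1 mulr1 => /(vge_sqr_inv hk) hc.
by rewrite eT; apply: (vge_mul hk (m := v 2) (n := 0)) => //; [lia | right].
Qed.

Lemma nrm_add1_integral x : vge 0 (nrm x) -> vge 0 (nrm (1 + x)).
Proof.
move=> hx; rewrite nrmD1; apply: (vgeD hk) => //; apply: (vgeD hk); last exact: qtr_integral.
by right; rewrite (v_one hk).
Qed.

(** Dividing by the term whose norm has the smaller valuation reduces to [1 + z] with [z] integral,
    where only the trace matters. *)
Lemma nrm_ultra n x y : vge n (nrm x) -> vge n (nrm y) -> vge n (nrm (x + y)).
Proof.
wlog le : x y / vge (v (nrm y)) (nrm x) => [hw|] hx hy.
  have [ge|lt] := leP (v (nrm y)) (v (nrm x)); first by apply: hw => //; right.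
  by rewrite addrC; apply: hw => //; right; apply: ltW.
have [->|y0] := eqVneq y 0; first by rewrite addr0.
have n0 : nrm y != 0 by rewrite nrm_eq0.
have -> : x + y = (1 + x * qiv y) * y.
  by rewrite mulrDl mul1r -mulrA qVmul // mulr1 addrC.
rewrite nrmM; apply: (vge_mul hk (m := 0)) hy; first by rewrite add0r.
apply: nrm_add1_integral; rewrite nrmM nrmV.
by apply: vge_le (vge_div hk n0 le); rewrite subrr.
Qed.

Lemma nrm_ultraB n x y : vge n (nrm x) -> vge n (nrm y) -> vge n (nrm (x - y)).
Proof. by move=> hx hy; apply: nrm_ultra => //; rewrite nrmN. Qed.

(** * Pure quaternions, the quadratic fields they generate and their similarity *)

Section PureElement.
Variables (c : D) (pc : pure c) (c0 : c != 0).
Local Notation NK := (binorm (- nrm c)).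

Lemma nrm_subfield (s t : k) : nrm (s%:A + t *: c) = s ^+ 2 - (- nrm c) * t ^+ 2.
Proof.
have -> : s%:A + t *: c = Quat (s + t * q0 c) (t * q1 c) (t * q2 c) (t * q3 c) :> D.
  by rewrite -qscalE; case: c => ? ? ? ?; congr Quat => /=; ring.
by rewrite /nrm /qnorm /= pc; ring.
Qed.

Lemma norm_fromE n : norm_from a b c n <-> NK n.
Proof.
have e (s t : k) : qadd (qscal s) (qmul a b (qscal t) c) = s%:A + t *: c :> D.
  have -> : t *: c = t%:A * c :> D by rewrite -scalerAl mul1r.
  by rewrite -!qscalE.
split=> [[s [t [st ->]]]|[n0 [s [t h]]]].
  split; last by exists s, t; rewrite e [qnorm _ _ _]nrm_subfield.
  rewrite e [qnorm _ _ _ == 0]nrm_eq0; apply/eqP => h; apply: st.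
  have t0 : t = 0.
    apply/eqP; apply: contraT => t0; case/eqP: c0.
    have ec : c = (- s / t)%:A.
      rewrite -[c](scalerK t0) (_ : t *: c = - s%:A) ?scaleNr ?scalerN; last first.
        by apply/eqP; rewrite -addr_eq0 addrC h.
      by rewrite scalerA mulrC mulNr scaleNr.
    by move: pc; rewrite ec -qscalE /pure /= => ->.
  by move: h; rewrite t0 scale0r addr0 -qscalE => -[->].
exists s, t; split; last by rewrite e h -nrm_subfield.
by case=> s0 t0; move/eqP: n0; apply; rewrite h s0 t0; ring.
Qed.

(** The centralizer of [c] is k(c): if the pure part of [x] commutes with [c], its product with [c]
    is fixed by conjugation, hence a scalar. *)
Lemma centralizer_norm x : x != 0 -> x * c = c * x -> NK (nrm x).
Proof.
move=> x0 xc; split; first by rewrite nrm_eq0.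
pose x' := x - (q0 x)%:A.
have cx' : qbar x' = - x'.
  by rewrite /x' -qscalE; case: (x) => ? ? ? ?; congr Quat => /=; ring.
have x'c : x' * c = c * x' by rewrite mulrBl mulrBr xc -scalerAl -scalerAr mul1r mulr1.
have [s hs] : exists s, x' * c = s%:A.
  exists (q0 (x' * c)); apply: (qbar_fixed (two_neq0 hk)).
  by rewrite qbarM cx' (pure_qbar pc) mulrNN x'c.
have nc0 : nrm c != 0 by rewrite nrm_eq0.
exists (q0 x), (- s / nrm c); rewrite -nrm_subfield; congr (nrm _).
rewrite -[LHS](subrK (q0 x)%:A) addrC; congr (_ + _).
apply: (qmulIr c0); rewrite -/x' hs -scalerAl (pure_sqr pc) scalerN scalerA -scaleNr.
by congr (_ *: _); rewrite mulNr mulNr opprK divfK.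
Qed.

(** Taking norms gives [nrm r = 1], whence the claim, or [nrm r = -1]. In the second case [r]
    anticommutes with [c], so it has trace 0 and square 1, and [r] is 1 or -1, which commutes with
    [c] anyway. *)
Lemma isometry_centralizes r : r * c * qbar r = c -> r * c = c * r.
Proof.
move=> h; have nc0 : nrm c != 0 by rewrite nrm_eq0.
have twist : nrm r *: (r * c) = c * r.
  by rewrite -{2}h -mulrA qbar_mul -scalerAr mulr1.
have /eqP : nrm r ^+ 2 = 1.
  apply: (mulIf nc0); rewrite mul1r -{2}h !nrmM nrmC; ring.
rewrite sqrf_eq1 => /orP[/eqP n1|/eqP n1]; first by rewrite -twist n1 scale1r.
have anti : c * r = - (r * c) by rewrite -twist n1 scaleN1r.
have r0 : r != 0 by rewrite -nrm_eq0 n1 oppr_eq0 oner_neq0.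
have tr0 : qtr r = 0.
  have h2 : c * (r * r) = (r * r) * c.
    by rewrite mulrA anti mulNr -[r * c * r]mulrA anti mulrN opprK mulrA.
  move: h2; rewrite cayley mulrBr mulrBl -!scalerAr -!scalerAl mulr1 mul1r.
  move=> /addIr /eqP; rewrite -subr_eq0 -scalerBr anti => /eqP h3.
  have [//|t0] := eqVneq (qtr r) 0; case/eqP: (qmul_neq0 r0 c0).
  move/(congr1 ( *:%R (qtr r)^-1)): h3; rewrite scaler0 scalerA mulVf // scale1r.
  by rewrite -opprD => /eqP; rewrite oppr_eq0 => /eqP /double_eq0.
have sq : (r - 1) * (r + 1) = 0.
  rewrite mulrBl !mulrDr mulr1 !mul1r cayley tr0 n1 scale0r sub0r scaleN1r opprK.
  by rewrite [1 + r]addrC subrr.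
have : (r == 1) || (r == - 1).
  rewrite -subr_eq0 -addr_eq0 -[_ + 1 == 0]nrm_eq0 -[_ == 0]nrm_eq0 -mulf_eq0 -nrmM sq.
  by rewrite nrm0.
by case/orP => /eqP ->; rewrite ?mulNr ?mulrN mul1r mulr1.
Qed.

(** Orthogonal pure quaternions anticommute. The witness is orthogonal to [c] by inspection; it
    vanishes when [c] is a multiple of ij, and then i serves. *)
Lemma exists_anticommuting : exists j : D, [/\ j != 0, pure j & c * j = - (j * c)].
Proof.
have [/eqP a0 [/eqP b0 _]] := hD.
have [/andP[/eqP h1 /eqP h2]|h] := boolP ((q1 c == 0) && (q2 c == 0)).
  exists (Quat 0 1 0 0 : D); split=> //; first by apply/eqP => -[/eqP]; rewrite oner_eq0.
  move: pc h1 h2; case: c => ? ? ? ?; rewrite /pure /= => -> -> ->.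
  by congr Quat => /=; ring.
exists (Quat 0 (- (b * q2 c)) (a * q1 c) 0 : D); split=> //.
  apply: contraNN h => /eqP -[/eqP]; rewrite oppr_eq0 mulf_eq0 (negbTE b0) /= => -> /eqP.
  by rewrite mulf_eq0 (negbTE a0) /= => ->.
by move: pc; case: c => ? ? ? ?; rewrite /pure /= => ->; congr Quat => /=; ring.
Qed.

(** If [- nrm j] were the norm of [m] in k(c), then [m + j] would have norm 0, so [j] would lie in
    k(c) and commute with [c]. *)
Lemma anticommuting_not_norm (j : D) : j != 0 -> pure j -> c * j = - (j * c) ->
  ~ NK (- nrm j).
Proof.
move=> j0 pj anti [_ [s [t h]]].
pose m : D := s%:A + t *: c.
have mj : j * qbar m = m * j.
  rewrite /m qbarD !qbarZ qbar1 (pure_qbar pc) mulrDl mulrDr -!scalerAl -!scalerAr.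
  by rewrite anti mulrN mul1r mulr1.
have : (m + j) * qbar (m + j) = 0.
  rewrite qbarD mulrDl !mulrDr mj (pure_qbar pj) mulrN [j * - j]mulrN qmul_qbar.
  rewrite (pure_sqr pj) opprK nrm_subfield -h scaleNr.
  by rewrite -addrA addKr addNr.
rewrite qmul_qbar => /(congr1 (@nrm k a b)); rewrite nrmZ nrm1 nrm0 mulr1.
move=> /eqP; rewrite sqrf_eq0 nrm_eq0 addr_eq0 => /eqP mj'.
have cm : c * m = m * c by rewrite mulrDl mulrDr -!scalerAl -!scalerAr mul1r mulr1.
move: cm; rewrite mj' mulrN mulNr => /oppr_inj; rewrite anti => /eqP.
rewrite eq_sym -subr_eq0 opprK => /eqP /double_eq0 /eqP.
by apply/negP; exact: qmul_neq0.
Qed.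

(** An element [m] of k(c) scales [c] by its norm, and [j] anticommuting with [c] scales it by
    [- nrm j], which is not a norm. By the index 2 theorem these scalings reach every [s]. *)
Lemma scale_represented (s : k) : s != 0 ->
  exists m : D, m != 0 /\ m * c * qbar m = s *: c.
Proof.
move=> s0; have nc0 : - nrm c != 0 by rewrite oppr_eq0 nrm_eq0.
have sub n : NK n -> exists m : D, [/\ m != 0, m * c = c * m & nrm m = n].
  move=> [n0 [x [y h]]]; exists (x%:A + y *: c); rewrite -nrm_eq0 nrm_subfield -h; split=> //.
  by rewrite mulrDl mulrDr -!scalerAl -!scalerAr mul1r mulr1.
have [j [j0 pj anti]] := exists_anticommuting.
have nj0 : nrm j != 0 by rewrite nrm_eq0.
have njN : - nrm j != 0 by rewrite oppr_eq0.
have [/sub[m [m0 mc nm]]|/(anticommuting_not_norm j0 pj anti)//|/sub[m [m0 mc nm]]] :=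
  binorm_index2 hk nc0 s0 njN.
  by exists m; rewrite mc -mulrA qmul_qbar nm -scalerAr mulr1.
have jV0 : (nrm j)^-1 != 0 by rewrite invr_eq0.
exists (m * ((nrm j)^-1 *: j)); split.
  by rewrite qmul_neq0 // -nrm_eq0 nrmZ mulf_neq0 ?expf_neq0.
rewrite qbarM qbarZ -!scalerAr -!scalerAl -!scalerAr scalerA (pure_qbar pj).
have -> : m * j * c * (- j * qbar m) = - (nrm j * nrm m) *: c.
  rewrite -!mulrA (mulrA j c) (_ : j * c = - (c * j)); last by rewrite anti opprK.
  rewrite !mulNr !mulrN opprK !mulrA mc -[c * m * j * j]mulrA (pure_sqr pj).
  rewrite mulrN mulNr -scalerAr mulr1 -scalerAl -mulrA qmul_qbar -scalerAr mulr1 scalerA.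
  by rewrite scaleNr.
rewrite nm scalerA; congr (_ *: _).
by field.
Qed.

(** Explicit Skolem-Noether: [z] and [u *: c] are pure of equal norm, and [z + u *: c] intertwines
    them when nonzero. The scalar left over is absorbed by [scale_represented]. *)
Lemma pure_similar (z : D) (u : k) : pure z -> u != 0 -> nrm z = nrm c * u ^+ 2 ->
  exists l : D, l != 0 /\ l * c * qbar l = z.
Proof.
move=> pz u0 nz.
suff [s [q [s0 q0 h]]] : exists (s : k) (q : D), [/\ s != 0, q != 0 & q * (s *: c) * qbar q = z].
  have [m [m0 hm]] := scale_represented s0.
  exists (q * m); split; first exact: qmul_neq0.
  by rewrite qbarM -h -hm !mulrA.
have [e|ne] := eqVneq (z + u *: c) 0.
  exists (- u), 1; rewrite oppr_eq0 oner_neq0 qbar1 mulr1 mul1r; split=> //.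
  by apply/eqP; rewrite scaleNr eq_sym -addr_eq0 e.
set q := z + u *: c in ne.
have nq0 : nrm q != 0 by rewrite nrm_eq0.
exists (u / nrm q), q; split=> //; first by rewrite mulf_neq0 ?invr_eq0.
have qz : q * (u *: c) = z * q.
  rewrite mulrDl mulrDr; rewrite addrC; congr (_ + _).
  rewrite -scalerAl -scalerAr scalerA (pure_sqr pc) (pure_sqr pz) scalerN scalerA.
  by congr (- (_ *: _)); rewrite nz; ring.
rewrite mulrC -scalerA -scalerAr -scalerAl qz -mulrA qmul_qbar -scalerAr mulr1 scalerA.
by rewrite mulVf // scale1r.
Qed.

End PureElement.

End QuaternionDivision.

(** * Rotations and spinor norms *)

Section SkewHermitianPlane.
Variables (k : fieldType) (v : k -> int) (hk : dyadic_local_field v).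
Variables (a b : k) (hD : quat_division a b).
Local Notation D := (quatalg a b).
Local Notation vge := (vge v).
Local Notation V := (D * D)%type.
Variables (a1 a2 : D) (p1 : pure a1) (p2 : pure a2) (a10 : a1 != 0) (a20 : a2 != 0).
Implicit Types (x y s w : V) (sg c : D).

Definition hm x y : D := x.1 * a1 * qbar y.1 + x.2 * a2 * qbar y.2.
Definition vmuladd c x y : V := (c * x.1 + y.1, c * x.2 + y.2).
Definition rt s sg x : V := vmuladd (- (hm x s * qiv sg)) s x.
Definition rdata s sg := sg != 0 /\ sg - qbar sg = hm s s.

Lemma rot_rt s sg x : Defs.rot a b a1 a2 s sg x = rt s sg x.
Proof.
rewrite /rt /vmuladd !mulNr; congr pair; rewrite addrC; exact: erefl.
Qed.

Lemma rot_dataE s sg : rot_data a b a1 a2 s sg <-> rdata s sg.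
Proof. by split=> -[s0 h]; split; [exact/eqP | exact: h | exact: (elimN eqP s0) | exact: h]. Qed.

Lemma hm_skew x y : qbar (hm x y) = - hm y x.
Proof.
by rewrite qbarD !qbarM !qbarK (pure_qbar p1) (pure_qbar p2) !mulNr !mulrN -opprD !mulrA.
Qed.

Lemma hm_linl c x y s : hm (vmuladd c x y) s = c * hm x s + hm y s.
Proof. by rewrite /hm /= !mulrDl mulrDr !mulrA addrACA. Qed.

Lemma hm_linr c x y s : hm s (vmuladd c x y) = hm s x * qbar c + hm s y.
Proof.
apply: (can_inj (@qbarK _ _ _)); rewrite hm_skew hm_linl [RHS]qbarD qbarM qbarK !hm_skew.
by rewrite mulrN opprD.
Qed.

Lemma rt_isometry s sg x y : rdata s sg -> hm (rt s sg x) (rt s sg y) = hm x y.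
Proof.
move=> [s0 hs]; rewrite /rt hm_linl !hm_linr -hs.
set X := hm x s; set Y := hm y s.
have -> : hm s y = - qbar Y by rewrite hm_skew opprK.
have cs0 : qbar sg != 0 by exact: qbar_neq0.
rewrite !qbarN !qbarM qbarV !mulrN -opprD mulrNN mulrDr.
have -> : X * qiv sg * ((sg - qbar sg) * (qiv (qbar sg) * qbar Y))
       = X * (qiv (qbar sg) * qbar Y) - X * qiv sg * qbar Y.
  rewrite mulrBl mulrBr; congr (_ - _).
    by rewrite -!mulrA (mulrA (qiv sg)) qVmul // mul1r.
  by rewrite (mulrA (qbar sg)) qmulV // mul1r.
by rewrite subrK addrA subrr add0r.
Qed.

(** [(s; - qbar sg)] is the inverse of the rotation [(s; sg)]. *)
Lemma rdataN s sg : rdata s sg -> rdata s (- qbar sg).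
Proof.
move=> [s0 hs]; split; first by rewrite oppr_eq0; exact: qbar_neq0.
by rewrite qbarN qbarK opprK addrC.
Qed.

Lemma qivN c : qiv (- c) = - qiv c.
Proof. by rewrite !qivE nrmN qbarN scalerN. Qed.

Lemma rt_inv s sg x : rdata s sg -> rt s (- qbar sg) (rt s sg x) = x.
Proof.
move=> [s0 hs]; have cs0 : qbar sg != 0 by exact: qbar_neq0.
have e : hm (rt s sg x) s * qiv (- qbar sg) = - (hm x s * qiv sg).
  rewrite hm_linl -hs mulNr -mulrA mulrBr qVmul // mulrBr mulr1 opprB subrK.
  by rewrite qivN mulrN -!mulrA qmulV // mulr1.
rewrite {1}/rt e opprK /rt /vmuladd /= !mulNr !addrA !subrr !add0r.
by case: (x).
Qed.

Lemma rt_invr s sg x : rdata s sg -> rt s sg (rt s (- qbar sg) x) = x.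
Proof. by move=> /rdataN /rt_inv - /(_ x); rewrite qbarN qbarK opprK. Qed.

Lemma rt_lin s sg c x y : rt s sg (vmuladd c x y) = vmuladd c (rt s sg x) (rt s sg y).
Proof.
rewrite /rt hm_linl; move: (hm x s) (hm y s) => X Y.
by congr pair; rewrite /= !mulNr !mulrDl !mulrDr opprD !mulrN !mulrA addrACA.
Qed.

(** The hypothesis lists the norms of the matrix entries [a_i * qbar s_i * qiv sg * s_j] of the
    rotation minus the identity. They are unchanged for the inverse rotation. *)
Lemma rt_lattice s sg : sg != 0 ->
  (forall c, c = s.1 \/ c = s.2 ->
     vge 0 (nrm a1 * nrm s.1 * nrm c / nrm sg) /\ vge 0 (nrm a2 * nrm s.2 * nrm c / nrm sg)) ->
  forall x, in_lattice a b v x -> in_lattice a b v (rt s sg x).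
Proof.
move=> s0 hb x [hx1 hx2].
have key c (c0 : D) : c = s.1 \/ c = s.2 -> vge 0 (nrm c0) ->
    vge 0 (nrm (- (hm x s * qiv sg) * c + c0)).
  move=> /hb [h1 h2] h0; apply: (nrm_ultra hk hD) => //.
  rewrite mulNr nrmN -mulrA mulrDl; apply: (nrm_ultra hk hD).
    rewrite !nrmM nrmV nrmC (_ : _ * _ = nrm x.1 * (nrm a1 * nrm s.1 * nrm c / nrm sg)); last by ring.
    exact: (vge_mul hk (m := 0) (n := 0)).
  rewrite !nrmM nrmV nrmC (_ : _ * _ = nrm x.2 * (nrm a2 * nrm s.2 * nrm c / nrm sg)); last by ring.
  exact: (vge_mul hk (m := 0) (n := 0)).
by split; apply: key => //; [left | right].
Qed.

Lemma rt_stabilizes s sg : rdata s sg ->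
  (forall c, c = s.1 \/ c = s.2 ->
     vge 0 (nrm a1 * nrm s.1 * nrm c / nrm sg) /\ vge 0 (nrm a2 * nrm s.2 * nrm c / nrm sg)) ->
  stabilizes a b v (Defs.rot a b a1 a2 s sg).
Proof.
move=> hs hb; split=> [x hx|y hy]; first by rewrite rot_rt; apply: rt_lattice => //; case: hs.
exists (rt s (- qbar sg) y); split; last by rewrite rot_rt rt_invr.
apply: rt_lattice => //; first by case: (rdataN hs).
by rewrite nrmN nrmC.
Qed.

Lemma rdata_expand (c r : D) : pure c ->
  c * (1 - qbar r) - qbar (c * (1 - qbar r)) - (1 - r) * c * qbar (1 - r) = c - r * c * qbar r.
Proof.
case: c r => c0 c1 c2 c3 [r0 r1 r2 r3]; rewrite /pure /= => ->.
by congr Quat => /=; ring.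
Qed.

(** For vectors of the shape allowed in B with m = 1, the rotation condition says that [(r, lam)],
    the image of the first basis vector, has length [a1]. *)
Lemma rdata_e1P (r lam : D) :
  a1 * (1 - qbar r) - qbar (a1 * (1 - qbar r)) = hm (1 - r, - lam) (1 - r, - lam) <->
  r * a1 * qbar r + lam * a2 * qbar lam = a1.
Proof.
have h := rdata_expand r p1.
have -> : hm (1 - r, - lam) (1 - r, - lam) = (1 - r) * a1 * qbar (1 - r) + lam * a2 * qbar lam.
  by rewrite /hm /= qbarN mulrN mulNr mulNr opprK.
split=> e.
  by move: h; rewrite e addrAC subrr add0r => ->; rewrite addrC subrK.
apply/eqP; rewrite [X in _ == X]addrC -subr_eq h -[X in X - _]e.
by rewrite addrAC subrr add0r.
Qed.

Lemma rdata_e1 (r lam : D) : 1 - r != 0 ->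
  r * a1 * qbar r + lam * a2 * qbar lam = a1 -> rdata (1 - r, - lam) (a1 * (1 - qbar r)).
Proof.
move=> r1 hr; split; last exact/rdata_e1P.
by rewrite (qmul_neq0 hD) // -qbar1 -qbarB (qbar_neq0 hD).
Qed.

Lemma stabilizes_e1 (r lam : D) : 1 - r != 0 -> vge 0 (nrm r) -> vge 0 (nrm lam) ->
  r * a1 * qbar r + lam * a2 * qbar lam = a1 -> vge 0 (nrm a2 / nrm a1) ->
  stabilizes a b v (Defs.rot a b a1 a2 (1 - r, - lam) (a1 * (1 - qbar r))).
Proof.
move=> r1 hr hl e h21; apply: rt_stabilizes; first exact: rdata_e1.
have N0 : nrm a1 != 0 by rewrite (nrm_eq0 hD).
have E0 : nrm (1 - r) != 0 by rewrite (nrm_eq0 hD).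
have hE : vge 0 (nrm (1 - r)).
  by apply: (nrm_ultraB hk hD) => //; rewrite nrm1; right; rewrite (v_one hk).
have nE : nrm (1 - qbar r) = nrm (1 - r) by rewrite -nrmC qbarB qbar1 qbarK.
rewrite /= !nrmM nE nrmN.
(* The one matrix entry that is not visibly integral: [lam * a2 * qbar lam = a1 - r * a1 * qbar r]
   splits into two terms, each of norm divisible by [nrm a1 * nrm (1 - r)]. *)
have e22 : vge 0 (nrm a2 * nrm lam * nrm lam / (nrm a1 * nrm (1 - r))).
  have -> : nrm a2 * nrm lam * nrm lam = nrm ((1 - r) * a1 + r * a1 * (1 - qbar r)).
    rewrite (_ : _ + _ = lam * a2 * qbar lam); last first.
      by rewrite -[X in (1 - r) * X]e mulrBl mul1r e mulrBr mulr1 addrA subrK -{1}e addrAC subrr add0r.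
    by rewrite !nrmM nrmC; ring.
  apply: vge_le (vge_div hk (mulf_neq0 N0 E0) (_ : vge (v (nrm a1 * nrm (1 - r))) _)).
    by rewrite subrr.
  apply: (nrm_ultra hk hD); first by rewrite nrmM mulrC; right.
  rewrite !nrmM nE -mulrA; apply: (vge_mul hk (m := 0)) hr (vge_val _ _); by rewrite add0r.
move=> c [->|->]; rewrite ?nrmN; split.
- by rewrite (_ : _ / _ = nrm (1 - r)) //; field; rewrite E0 N0.
- rewrite (_ : _ / _ = nrm a2 / nrm a1 * nrm lam); first exact: (vge_mul hk (m := 0) (n := 0)).
  by field; rewrite E0 N0.
- by rewrite (_ : _ / _ = nrm lam) //; field; rewrite E0 N0.
- by [].
Qed.

(** For [n] the norm of [t = x + y a1] with y nonzero, the rotation along [2 y s1] with [sg = 2 y t]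
    acts on the line of s1 only. Its entry has norm [nrm (t - qbar t) / nrm t], integral by the
    ultrametric inequality. *)
Lemma subfield_spinor_norms (n : k) : binorm (- nrm a1) n ->
  exists l, [/\ all_rot_data a b a1 a2 l, stabilizes a b v (rot_prod a b a1 a2 l) &
    exists u, u != 0 /\ n = norm_prod a b l * u ^+ 2].
Proof.
move=> [n0 [x [y hn]]]; have t0 := two_neq0 hk.
have [y0|y0] := eqVneq y 0.
  exists [::]; split=> //; first by split=> // z hz; exists z.
  exists x; split; last by rewrite hn y0 /=; ring.
  by move: n0; rewrite hn y0 expr0n mulr0 subr0 sqrf_eq0.
pose t : D := x%:A + y *: a1.
have nt : nrm t = n by rewrite nrm_subfield.
have y20 : 2 * y != 0 by rewrite mulf_neq0.
have dt : t - qbar t = (2 * y) *: a1.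
  rewrite /t qbarD !qbarZ qbar1 (pure_qbar p1) scalerN opprB addrC addrA subrK -scalerDl.
  by congr (_ *: _); ring.
pose s : V := ((2 * y)%:A, 0); pose sg : D := (2 * y) *: t.
have hs : rdata s sg.
  split; first by rewrite -(nrm_eq0 hD) nrmZ nt mulf_neq0 ?expf_neq0.
  rewrite /hm /= qbar0 mulr0 addr0 qbarZ -scalerBr dt qbarZ qbar1 -scalerAr -!scalerAl mulr1 mul1r.
  by rewrite scalerA.
have st : stabilizes a b v (Defs.rot a b a1 a2 s sg).
  apply: rt_stabilizes => // c; rewrite /= nrm0 !(mulr0, mul0r) => hc; split; last by left.
  case: hc => ->; last by rewrite nrm0 mulr0 mul0r; left.
  rewrite !nrmZ nrm1 nt (_ : _ / _ = nrm ((2 * y) *: a1) / n); last first.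
    by rewrite nrmZ; field; rewrite n0 y0; apply/eqP; exact: (dlf_char0 hk (n := 3%N)).
  apply: vge_le (vge_div hk n0 (_ : vge (v n) _)); first by rewrite subrr.
  by rewrite -dt; apply: (nrm_ultraB hk hD); rewrite ?nrmC nt; right.
exists [:: (s, sg)]; split.
- by split=> //; apply/rot_dataE.
- exact: st.
- exists (2 * y)^-1; rewrite invr_eq0; split=> //=.
  by rewrite mulr1 [qnorm a b sg]nrmZ nt; field; rewrite ?y0 ?t0 ?y20.
Qed.

Lemma rot_prod_isometry l x y : all_rot_data a b a1 a2 l ->
  hm (rot_prod a b a1 a2 l x) (rot_prod a b a1 a2 l y) = hm x y.
Proof.
elim: l => [//|[s sg] l IH] [/rot_dataE hs /IH e].
have step z : rot_prod a b a1 a2 ((s, sg) :: l) z = rt s sg (rot_prod a b a1 a2 l z).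
  exact: rot_rt.
by rewrite !step rt_isometry.
Qed.

Lemma rot_prod_lin l c x y : rot_prod a b a1 a2 l (vmuladd c x y)
  = vmuladd c (rot_prod a b a1 a2 l x) (rot_prod a b a1 a2 l y).
Proof.
elim: l => [//|[s sg] l IH].
have step z : rot_prod a b a1 a2 ((s, sg) :: l) z = rt s sg (rot_prod a b a1 a2 l z).
  exact: rot_rt.
by rewrite !step IH rt_lin.
Qed.

(** * The spinor norm modulo norms, read on isotropic vectors *)

Section SpinorNorm.
Variables (q : D) (hq : q * a1 * qbar q = - a2).
Local Notation NK := (binorm (- nrm a1)).

(** The second condition only excludes the zero vector, the line of [a2] being anisotropic. By [hq]
    the vector [(q, 1)] is an example. *)
Definition isotropic w := hm w w = 0 /\ w.1 != 0.

(** Isotropic lines are parametrized by the norm-one group of k(a1): by [hq], isotropy says that [m]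
    is an isometry of the line of [a1], and [isometry_centralizes] applies. *)
Lemma isotropic_form w : isotropic w ->
  exists m : D, [/\ m * a1 = a1 * m, m * qbar m = 1 & w.2 * q = w.1 * m].
Proof.
move=> [h w0]; exists (qiv w.1 * (w.2 * q)).
set m := qiv _ * _.
have wm : w.1 * m = w.2 * q by rewrite mulrA qmulV // mul1r.
have hm1 : m * a1 * qbar m = a1.
  apply: (qmulI hD w0); apply: (qmulIr hD (qbar_neq0 hD w0)).
  rewrite -[RHS]mulrA.
  have -> : w.1 * (m * a1 * qbar m) * qbar w.1 = (w.1 * m) * a1 * qbar (w.1 * m).
    by rewrite qbarM !mulrA.
  rewrite wm qbarM.
  have -> : w.2 * q * a1 * (qbar q * qbar w.2) = w.2 * (q * a1 * qbar q) * qbar w.2 by rewrite !mulrA.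
  rewrite hq mulrN mulNr mulrA; apply/eqP; rewrite eq_sym -addr_eq0.
  by apply/eqP; exact: h.
have mc := isometry_centralizes hk hD a10 hm1.
split=> //; apply: (qmulI hD a10).
by rewrite mulrA -mc hm1 mulr1.
Qed.

Lemma hm_isotropic w w' m m' : w.2 * q = w.1 * m -> w'.2 * q = w'.1 * m' ->
  hm w w' = w.1 * (a1 - m * a1 * qbar m') * qbar w'.1.
Proof.
move=> e e'; rewrite /hm mulrBr mulrBl; congr (_ + _).
have -> : a2 = - (q * a1 * qbar q) by rewrite hq opprK.
rewrite mulrN mulNr; congr (- _).
have -> : w.2 * (q * a1 * qbar q) * qbar w'.2 = (w.2 * q) * a1 * qbar (w'.2 * q).
  by rewrite qbarM !mulrA.
by rewrite e e' qbarM !mulrA.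
Qed.

(** By [hm_isotropic] the value is [w.1 * K * qbar w'.1] with K in k(a1), since both parameters [m]
    and [m'] commute with [a1]. *)
Lemma isotropic_pair w w' : isotropic w -> isotropic w' -> hm w w' != 0 ->
  NK (nrm w.1 * nrm w'.1 * nrm (hm w w')).
Proof.
move=> iw iw'; have [m [mc _ e]] := isotropic_form iw.
have [m' [mc' _ e']] := isotropic_form iw'.
rewrite (hm_isotropic e e'); set K := a1 - _ => n0.
have w0 : nrm w.1 != 0 by rewrite (nrm_eq0 hD); case: iw.
have w0' : nrm w'.1 != 0 by rewrite (nrm_eq0 hD); case: iw'.
have K0 : K != 0 by apply: contraNneq n0 => ->; rewrite mulr0 mul0r.
have cm' : qbar m' * a1 = a1 * qbar m'.
  apply: (can_inj (@qbarK _ _ _)); rewrite !qbarM qbarK (pure_qbar p1) mulNr mulrN.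
  by rewrite mc'.
have Kc : K * a1 = a1 * K.
  by rewrite mulrBl mulrBr -[m * a1 * qbar m' * a1]mulrA cm' !mulrA -mc.
have NKK := centralizer_norm hk hD p1 a10 K0 Kc.
rewrite !nrmM nrmC (_ : _ * _ = nrm K * (nrm w.1 * nrm w'.1) ^+ 2); last by ring.
by apply: binorm_mul => //; apply: binorm_sqr; rewrite mulf_neq0.
Qed.

Lemma isotropic_rt s sg w : rdata s sg -> isotropic w -> isotropic (rt s sg w).
Proof.
move=> hs [hw w0]; split; first by rewrite rt_isometry.
have hw' : hm (rt s sg w) (rt s sg w) = 0 by rewrite rt_isometry.
apply: contraNneq w0 => z1.
have z2 : (rt s sg w).2 = 0.
  apply/eqP; rewrite -(nrm_eq0 hD); move: hw'; rewrite /hm z1 !mul0r add0r.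
  move=> /(congr1 (@nrm k a b)); rewrite !nrmM nrmC nrm0 => /eqP.
  by rewrite !mulf_eq0 (nrm_eq0 hD a2) (negbTE a20) orbF orbb.
have z : rt s sg w = (0, 0) by rewrite [LHS]surjective_pairing z1 z2.
have := rt_inv w hs; rewrite z => <-.
by rewrite /rt /vmuladd /hm /= !(mul0r, addr0, oppr0).
Qed.

(* If [hm w s != 0] then [hm w (rt s sg w) = - y * qbar (qiv sg) * qbar y] for
   [y = hm w s], whose norm is [nrm sg] up to squares; otherwise [s] lies on the
   isotropic line of [w] and [sg] is a scalar. *)
Lemma spinor_step s sg w : rdata s sg -> isotropic w ->
  NK (nrm (rt s sg w).1 * nrm w.1 * nrm sg).
Proof.
move=> hs iw; have iw' := isotropic_rt hs iw.
have w0 : nrm w.1 != 0 by rewrite (nrm_eq0 hD); case: iw.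
have s0 : nrm sg != 0 by rewrite (nrm_eq0 hD); case: hs.
have [y0|y0] := eqVneq (hm w s) 0.
  have -> : rt s sg w = w.
    by rewrite /rt y0 mul0r oppr0 /vmuladd !mul0r !add0r; case: (w).
  have [m [mc m1 e]] := isotropic_form iw.
  have es : s.1 = s.2 * q * qbar m.
    have h : w.1 * (a1 * qbar s.1) = w.1 * (m * a1 * qbar q * qbar s.2).
      apply/eqP; rewrite -subr_eq0; apply/eqP.
      rewrite -[RHS]y0 /hm mulrA; congr (_ + _).
      have -> : a2 = - (q * a1 * qbar q) by rewrite hq opprK.
      by rewrite mulrN mulNr !mulrA e.
    have {}h := qmulI hD (proj2 iw) h.
    rewrite mc -!mulrA in h; have {}h := qmulI hD a10 h.
    by rewrite -[LHS]qbarK h !qbarM !qbarK.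
  have ss0 : hm s s = 0.
    rewrite /hm es !qbarM qbarK.
    have -> : s.2 * q * qbar m * a1 * (m * (qbar q * qbar s.2)) = s.2 * (q * (qbar m * (a1 * m)) * qbar q) * qbar s.2.
      by rewrite !mulrA.
    rewrite -mc (mulrA (qbar m)); have -> : qbar m * m = 1.
      move: m1; rewrite qmul_qbar -qbar_mul => ->; exact: erefl.
    by rewrite mul1r hq mulrN mulNr addNr.
  have fx : qbar sg = sg by apply/esym/eqP; rewrite -subr_eq0 (proj2 hs) ss0.
  move: s0; rewrite (nrm_fixed (two_neq0 hk) fx) -expr2 -exprMn => s0; apply: binorm_sqr.
  by rewrite mulf_neq0 //; move: s0; rewrite sqrf_eq0.
have e : hm w (rt s sg w) = - (hm w s * (qbar (qiv sg) * qbar (hm w s))).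
  by rewrite hm_linr (proj1 iw) addr0 qbarN qbarM mulrN.
have ny0 : nrm (hm w s) != 0 by rewrite (nrm_eq0 hD).
have h0 : hm w (rt s sg w) != 0.
  by rewrite e -(nrm_eq0 hD) nrmN !nrmM !nrmC nrmV !mulf_neq0 ?invr_eq0.
have := isotropic_pair iw iw' h0; rewrite e nrmN !nrmM !nrmC nrmV => h.
apply: (@binorm_cancel_sqr _ _ _ (nrm (hm w s) / nrm sg)); first by rewrite mulf_neq0 ?invr_eq0.
rewrite (_ : _ * _ ^+ 2 = nrm w.1 * nrm (rt s sg w).1 * (nrm (hm w s) * ((nrm sg)^-1 * nrm (hm w s)))) //.
by field.
Qed.

(** [spinor_step] telescopes: each intermediate first coordinate enters through the square of its
    norm. *)
Lemma spinor_prod l w : all_rot_data a b a1 a2 l -> isotropic w ->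
  isotropic (rot_prod a b a1 a2 l w) /\
  NK (nrm (rot_prod a b a1 a2 l w : V).1 * nrm w.1 * norm_prod a b l).
Proof.
move=> + iw; elim: l => [_|[s sg] l IH].
  split=> //=; rewrite mulr1 -expr2; apply: binorm_sqr; rewrite (nrm_eq0 hD); exact: (proj2 iw).
move=> [/rot_dataE hs /IH [il hl]].
have -> : rot_prod a b a1 a2 ((s, sg) :: l) w = rt s sg (rot_prod a b a1 a2 l w).
  exact: rot_rt.
split; first exact: isotropic_rt.
have h := binorm_mul (spinor_step hs il) hl.
apply: (@binorm_cancel_sqr _ _ _ (nrm (rot_prod a b a1 a2 l w : V).1)).
  by rewrite (nrm_eq0 hD); exact: (proj2 il).
have mix (A B C E F : k) : (A * B * E) * (B * C * F) = A * C * (E * F) * B ^+ 2 by ring.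
by rewrite mix in h; exact: h.
Qed.

Lemma rt_e1 (r lam : D) : 1 - r != 0 ->
  rt (1 - r, - lam) (a1 * (1 - qbar r)) (1, 0) = (r, lam).
Proof.
move=> r1; have sg0 : a1 * (1 - qbar r) != 0.
  by rewrite (qmul_neq0 hD) // -qbar1 -qbarB (qbar_neq0 hD).
rewrite /rt /hm /= mul1r mul0r mul0r addr0 qbarB qbar1 (qmulV hD sg0) /vmuladd /=.
by rewrite !mulN1r opprB opprK addr0 subrK.
Qed.

(* [rt s (- qbar sg)] maps [(r, lam)] to the first basis vector and [y] into its
   orthogonal complement, hence [w] to a vector of first coordinate [q]. *)
Lemma spinor_of_image (r lam : D) w y : 1 - r != 0 ->
  r * a1 * qbar r + lam * a2 * qbar lam = a1 ->
  w = vmuladd q (r, lam) y -> hm y (r, lam) = 0 -> isotropic w ->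
  NK (nrm q * nrm w.1 * nrm (a1 * (1 - qbar r))).
Proof.
move=> r1 hr ew hy iw; set s : V := (1 - r, - lam); set sg := a1 * _.
have hs : rdata s sg by exact: rdata_e1.
have hs' := rdataN hs.
have e1 : rt s (- qbar sg) (r, lam) = (1, 0) by rewrite -(rt_e1 lam r1) rt_inv.
have y1 : (rt s (- qbar sg) y).1 = 0.
  have : hm (rt s (- qbar sg) y) (1, 0) = 0 by rewrite -e1 rt_isometry.
  rewrite /hm /= qbar1 qbar0 mulr1 mulr0 addr0 => /eqP; rewrite -(nrm_eq0 hD) nrmM mulf_eq0.
  by rewrite !(nrm_eq0 hD) (negbTE a10) orbF => /eqP.
have e : (rt s (- qbar sg) w).1 = q.
  by rewrite ew rt_lin e1 -[LHS]/(q * 1 + (rt s (- qbar sg) y).1) y1 mulr1 addr0.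
have := spinor_step hs' iw; rewrite e.
by rewrite nrmN nrmC.
Qed.

End SpinorNorm.
End SkewHermitianPlane.

(** Anisotropy excludes solutions with [u = 0], and dividing by [u] exhibits [n] as a norm; for
    [n = 0] the symbol is 1. *)
Lemma hilbertN1 (k : fieldType) (d n : k) :
  (forall x y : k, (x, y) <> (0, 0) -> x ^+ 2 - d * y ^+ 2 != 0) ->
  hilbert n d = -1 <-> n != 0 /\ ~ binorm d n.
Proof.
move=> aniso; rewrite /hilbert; case: asboolP => [[z [u [w [nz e]]]]|no]; split=> //.
- move=> [n0 nn]; exfalso; apply: nn; split=> //.
  have [u0|u0] := eqVneq u 0.
    have zw : (z, w) <> (0, 0) by case=> z0 w0; apply: nz; rewrite z0 u0 w0.
    by have := aniso _ _ zw; rewrite e u0 expr0n mulr0 add0r subrr eqxx.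
  exists (z / u), (w / u); apply: (mulIf (expf_neq0 2 u0)).
  have -> : ((z / u) ^+ 2 - d * (w / u) ^+ 2) * u ^+ 2 = z ^+ 2 - d * w ^+ 2 by field.
  by rewrite e; ring.
- move=> _; split.
    apply/eqP => n0; apply: no; exists 0, 1, 0; split; last by rewrite n0; ring.
    by case=> /eqP; rewrite oner_eq0.
  move=> [n0 [x [y h]]]; apply: no; exists x, 1, y; split; last by rewrite h; ring.
  by case=> _ /eqP; rewrite oner_eq0.
Qed.

(** * Stabilizers of the lattice and the set B *)

Section SpinorNormsOfTheLattice.
Variables (k : fieldType) (v : k -> int) (hk : dyadic_local_field v).
Variables (a b : k) (hD : quat_division a b).
Local Notation D := (quatalg a b).
Local Notation vge := (vge v).
Local Notation V := (D * D)%type.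
Variables (a1 a2 : D) (p1 : pure a1) (p2 : pure a2) (a10 : a1 != 0) (a20 : a2 != 0).
Variables (u : k) (u0 : u != 0) (hu : nrm a2 = nrm a1 * u ^+ 2).
Hypothesis h21 : vge 0 (nrm a2 / nrm a1).
Local Notation NK := (binorm (- nrm a1)).

Let N10 : nrm a1 != 0. Proof. by rewrite (nrm_eq0 hD). Qed.

Lemma NK_a1 : NK (nrm a1).
Proof. by split=> //; exists 0, 1; ring. Qed.

Lemma subfield_aniso (x y : k) : (x, y) <> (0, 0) -> x ^+ 2 - (- nrm a1) * y ^+ 2 != 0.
Proof.
move=> xy; have : norm_from a b a1 (x ^+ 2 - (- nrm a1) * y ^+ 2).
  exists x, y; split=> //; rewrite -(nrm_subfield p1) -[RHS]/(nrm _); congr (nrm _).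
  by rewrite -(mul1r a1) scalerAl -!qscalE mul1r.
by move=> /(norm_fromE hD p1 a10) [].
Qed.

(** Since [nrm a1] is a norm, the class of sigma is that of [nrm (1 - r)], the quantity tested by
    the Hilbert symbol in (3). *)
Lemma NK_sigma (r : D) : NK (nrm (a1 * (1 - qbar r))) <-> NK (nrm (1 - r)).
Proof.
have nE : nrm (1 - qbar r) = nrm (1 - r) by rewrite -nrmC qbarB qbar1 qbarK.
rewrite nrmM nE; split=> [h|]; last exact: binorm_mul NK_a1.
by apply: (binorm_div NK_a1); rewrite mulrC.
Qed.

(** Here [1 - r] lies in k(c), whose norms are norms from k(a1) because [nrm c] is [nrm a1] up to a
    square. This disposes of [lam = 0] and of m = 2. *)
Lemma fixed_norm (c r : D) : pure c -> c != 0 ->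
  (exists s, nrm c = nrm a1 * s ^+ 2) ->
  r * c * qbar r = c -> 1 - r != 0 -> NK (nrm (1 - r)).
Proof.
move=> pc c0 [s hs] hr r1; have rc := isometry_centralizes hk hD c0 hr.
have [|n0 [x [y h]]] := centralizer_norm hk hD pc c0 r1.
  by rewrite mulrBl mulrBr mul1r mulr1 rc.
by split=> //; exists x, (s * y); rewrite h hs; ring.
Qed.

(** The two quaternions add up to 2, so they cannot both be strictly smaller than 2. *)
Lemma one_pm_large (r : D) :
  absle v (qnorm a b (qscal 2)) (nrm (1 - r)) \/ absle v (qnorm a b (qscal 2)) (nrm (1 - (- r))).
Proof.
have n2 : qnorm a b (qscal 2) = 2 ^+ 2 by rewrite /qnorm /=; ring.
have t0 := two_neq0 hk.
rewrite n2; have large x : ~ absle v (2 ^+ 2) (nrm x) -> vge (v (2 ^+ 2) + 1) (nrm (x : D)).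
  move=> h; have [->|x0] := eqVneq (nrm x) 0; first by left.
  right; have [le|] := leP (v (nrm x)) (v (2 ^+ 2)); last by lia.
  by exfalso; apply: h; right; split=> //; exact/eqP.
apply: contrapT => /not_orP [/large h1 /large h2].
have := nrm_ultra hk hD h1 h2; rewrite opprK.
have -> : (1 - r) + (1 + r) = (2 : k) *: (1 : D).
  by rewrite addrACA addNr addr0 scaler_nat mulr2n.
by rewrite nrmZ nrm1 mulr1 => /(vge_valE (expf_neq0 2 t0)); rewrite gerDl.
Qed.

Lemma not_all_norms : exists c : k, c != 0 /\ ~ NK c.
Proof.
have [j [j0 pj anti]] := exists_anticommuting hD p1.
exists (- nrm j); split; first by rewrite oppr_eq0 (nrm_eq0 hD).
exact: (anticommuting_not_norm hk hD p1 a10 j0 pj anti).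
Qed.

Lemma rotation_in_B (r lam : D) : absle v (qnorm a b (qscal 2)) (nrm (1 - r)) ->
  vge 0 (nrm r) -> vge 0 (nrm lam) -> r * a1 * qbar r + lam * a2 * qbar lam = a1 ->
  1 - r != 0 /\ in_B a b a1 a2 v (1 - r, - lam) (a1 * (1 - qbar r)).
Proof.
move=> big hr hl e.
have r1 : 1 - r != 0.
  case: big => [/eqP|[/eqP n0 _]]; last by rewrite -(nrm_eq0 hD).
  have -> : qnorm a b (qscal 2) = 2 ^+ 2 by rewrite /qnorm /=; ring.
  by rewrite sqrf_eq0 (negbTE (two_neq0 hk)).
split=> //; split; first by apply/rot_dataE; exact: rdata_e1.
split; first exact: stabilizes_e1.
by exists r; split=> //; split=> //; left; exists lam.
Qed.

(** The image of [(q, 1)] is [q * g(s1) + g(s2)]. Its first coordinate gives the class of [g] by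
    [spinor_prod], and by [spinor_of_image] the class of a rotation in B carrying s1 to g(s1); so
    the two classes agree. *)
Lemma stabilizer_norms_of_B :
  (forall s sg, in_B a b a1 a2 v s sg -> NK (qnorm a b sg)) ->
  forall l, all_rot_data a b a1 a2 l -> stabilizes a b v (rot_prod a b a1 a2 l) ->
  NK (norm_prod a b l).
Proof.
move=> HB l hl [stab _].
have [q [q0 hq']] : exists q : D, q != 0 /\ q * a1 * qbar q = - a2.
  apply: (pure_similar hk hD p1 a10 (u := u)) => //; last by rewrite nrmN.
  by apply: (qbar_pure (two_neq0 hk)); rewrite qbarN (pure_qbar p2).
pose g := rot_prod a b a1 a2 l : V -> V.
pose w : V := (q, 1).
have iw : isotropic a1 a2 w.
  by split=> //; rewrite /hm /= hq' qbar1 mulr1 mul1r addNr.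
have [igw hgw] := spinor_prod hk hD p1 p2 a10 a20 hq' hl iw.
have ew : w = vmuladd q (1, 0) (0, 1).
  by rewrite /vmuladd /= mulr1 addr0 mulr0 add0r.
have egw : g w = vmuladd q (g (1, 0)) (g (0, 1)) by rewrite /g ew rot_prod_lin.
have [hr hlam] : in_lattice a b v (g (1, 0)).
  apply: stab; split; last by left; exact: nrm0.
  by right; rewrite [qnorm a b _]nrm1 (v_one hk).
have hg1 : hm a1 a2 (g (1, 0)) (g (1, 0)) = a1.
  by rewrite rot_prod_isometry // /hm /= qbar1 qbar0 !mulr0 mulr1 mul1r addr0.
have hg2 : hm a1 a2 (g (0, 1)) (g (1, 0)) = 0.
  by rewrite rot_prod_isometry // /hm /= qbar0 !mul0r mulr0 addr0.
(* Stated for an arbitrary [w'] so as to serve both [g] and [-g]: the sign does not change the norm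
   of the first coordinate. *)
have fin (r lam : D) w' y : absle v (qnorm a b (qscal 2)) (nrm (1 - r)) ->
    vge 0 (nrm r) -> vge 0 (nrm lam) -> hm a1 a2 (r, lam) (r, lam) = a1 ->
    w' = vmuladd q (r, lam) y -> hm a1 a2 y (r, lam) = 0 -> isotropic a1 a2 w' ->
    nrm w'.1 = nrm (g w).1 -> NK (norm_prod a b l).
  move=> big hr' hl' e ew' hy iw' nw.
  have [r1 /HB NKs] := rotation_in_B big hr' hl' e.
  have h := spinor_of_image hk hD p1 p2 a10 a20 hq' r1 e ew' hy iw'.
  have {}h := binorm_div NKs h; rewrite nw in h.
  have h' := binorm_mul h hgw.
  have mix (A B C : k) : A * B * (B * A * C) = C * (A * B) ^+ 2 by ring.
  rewrite mix in h'; apply: binorm_cancel_sqr h'.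
  by rewrite mulf_neq0 ?(nrm_eq0 hD) //; case: igw.
have [big|big] := one_pm_large (g (1, 0)).1.
  apply: (fin (g (1, 0)).1 (g (1, 0)).2 (g w) (g (0, 1))) => //; rewrite -surjective_pairing //.
have negR x y : hm a1 a2 (vmuladd (-1) x (0, 0)) (vmuladd (-1) y (0, 0)) = hm a1 a2 x y.
  by rewrite /hm /= !mulN1r !addr0 !qbarN !mulNr !mulrN !opprK.
have neg (x : V) : (- x.1, - x.2) = vmuladd (-1) x (0, 0).
  by rewrite /vmuladd /= !mulN1r !addr0.
apply: (fin (- (g (1, 0)).1) (- (g (1, 0)).2) (- (g w).1, - (g w).2)
  (- (g (0, 1)).1, - (g (0, 1)).2)) => //.
- by rewrite nrmN.
- by rewrite nrmN.
- by rewrite neg negR.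
- by rewrite egw /vmuladd /= !opprD !mulrN.
- by rewrite !neg negR.
- split; first by rewrite neg negR; case: igw.
  by rewrite /= oppr_eq0; case: igw.
- exact: nrmN.
Qed.

End SpinorNormsOfTheLattice.

(** * The equivalence of the three conditions *)

Unset Implicit Arguments.

Theorem theorem3 (k : fieldType) (v : k -> int) (hk : dyadic_local_field v)
  (pi : k) (hpi : v pi = 1)
  (a b : k) (hD : quat_division a b)
  (a1 a2 : quat k)
  (ha1 : pure a1 /\ a1 <> qzero k) (ha2 : pure a2 /\ a2 <> qzero k)
  (h2a1 : absle v (qnorm a b a2) (qnorm a b (qmul a b (qscal 2) a1)))
  (hN : exists u : k, u <> 0 /\ qnorm a b a2 = qnorm a b a1 * u ^+ 2)
  (t : int)
  (ht : v (qnorm a b (qscal (pi ^ t))) = v (qnorm a b a2) - v (qnorm a b a1)) :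
  [<-> (forall c : k, c <> 0 -> in_H a b a1 a2 v c);
       (exists (s : vec k) (sigma : quat k), in_B a b a1 a2 v s sigma /\
          ~ norm_from a b a1 (qnorm a b sigma));
       (exists r : quat k, qintegral a b v r /\
          let z := qsub a1 (qmul a b (qmul a b r a1) (qconj r)) in
          hilbert (qnorm a b (qsub (qone k) r)) (- qnorm a b a1) = -1 /\
          is_nzsq (qnorm a b z * qnorm a b a1) /\
          integral v (qnorm a b z
                      / qnorm a b (qmul a b (qscal (pi ^ t)) a1)))].
Proof.
have [p1 /eqP a10] : pure a1 /\ (a1 : quatalg a b) <> 0 by exact: ha1.
have [p2 /eqP a20] : pure a2 /\ (a2 : quatalg a b) <> 0 by exact: ha2.
have [u [/eqP u0 hu]] := hN.
pose A1 : quatalg a b := a1; pose A2 : quatalg a b := a2.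
have N10 : nrm A1 != 0 by rewrite (nrm_eq0 hD).
have N20 : nrm A2 != 0 by rewrite (nrm_eq0 hD).
have t0 := two_neq0 hk; have e0 := dlf_dyadic hk.
have scal_norm (c : k) : qnorm a b (qmul a b (qscal c) a1) = c ^+ 2 * nrm A1.
  by rewrite [qnorm a b _](nrmM (qscal c : quatalg a b) A1) qscalE nrmZ nrm1 mulr1.
have hu' : nrm A2 = nrm A1 * u ^+ 2 by exact: hu.
have v21 : v (nrm A2) = v (nrm A1) + (v u + v u).
  by rewrite hu' (v_mul hk) ?expf_neq0 // (v_sqr hk).
have h21 : vge v 0 (nrm A2 / nrm A1).
  right; rewrite (v_mul hk) ?invr_eq0 // (v_inv hk) //.
  case: h2a1 => [/eqP|[_]]; first by rewrite (negbTE N20).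
  rewrite scal_norm (v_mul hk) ?expf_neq0 // (v_sqr hk) // -[qnorm a b a2]/(nrm A2); lia.
have P2 : qnorm a b (qscal (pi ^ t)) = (pi ^ t) ^+ 2.
  by rewrite -[LHS]/(nrm (qscal (pi ^ t) : quatalg a b)) qscalE nrmZ nrm1 mulr1.
(* [v 0] is unconstrained, so [pi != 0] has to be extracted from a parity argument. *)
have P0 : pi ^ t != 0.
  apply/eqP => z.
  have pi0 : pi = 0 by apply/eqP; apply: contraT => /expfz_neq0 - /(_ t); rewrite z eqxx.
  move: ht; rewrite P2 z expr2 mul0r -{1}pi0 hpi -[qnorm a b a2]/(nrm A2) v21.
  rewrite -[qnorm a b a1]/(nrm A1); lia.
have vP : v ((pi ^ t) ^+ 2) = v u + v u.
  by rewrite -P2 ht -[qnorm a b a2]/(nrm A2) v21 -[qnorm a b a1]/(nrm A1); lia.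
pose NK := binorm (- nrm A1).
have NKE n : norm_from a b a1 n <-> NK n by exact: (norm_fromE hD p1 a10).
have aniso := subfield_aniso hD p1 a10.
(* With [z = lam * a2 * qbar lam] and [L = nrm lam], the quotient in (3) has valuation [2 * v L], so
   its integrality is that of [lam]. *)
have nint (L : k) : L != 0 -> L ^+ 2 * nrm A2 / ((pi ^ t) ^+ 2 * nrm A1) != 0 /\
    v (L ^+ 2 * nrm A2 / ((pi ^ t) ^+ 2 * nrm A1)) = v L + v L.
  move=> L0; have L20 := expf_neq0 2 L0; have P20 := expf_neq0 2 P0.
  split; first by rewrite !mulf_neq0 ?invr_eq0 ?mulf_neq0.
  rewrite (v_mul hk (mulf_neq0 L20 N20)) ?invr_eq0 ?mulf_neq0 // (v_inv hk (mulf_neq0 P20 N10)).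
  rewrite (v_mul hk L20 N20) (v_mul hk P20 N10) (v_sqr hk L0) vP v21; ring.
tfae.
- move=> H1; apply: contrapT => no.
  have [c [c0 nc]] := not_all_norms hk hD p1 a10.
  have [_ [l [hl [st [w [/eqP w0 ec]]]]]] := H1 c (elimN eqP c0).
  apply: nc; rewrite ec; apply: binorm_mul; last exact: binorm_sqr.
  apply: (stabilizer_norms_of_B hk hD p1 p2 a10 a20 u0 hu' h21) st => // s sg hB.
  apply/NKE; apply: contrapT => nn; apply: no; by exists s, sg.
- move=> [s [sg [[/rot_dataE [sg0 hs] [_ [r [hr [_ h]]]]] nn]]].
  pose R : quatalg a b := r.
  have r1 : 1 - R != 0.
    apply/eqP => r1; have cr : 1 - qbar R = 0 by rewrite -qbar1 -qbarB r1 qbar0.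
    case/eqP: sg0; case: h => [[lam [_ [_ ->]]]|[_ ->]].
      by rewrite -[LHS]/(A1 * (1 - qbar R)) cr mulr0.
    by rewrite -[LHS]/(A2 * (1 - qbar R)) cr mulr0.
  (* For m = 2 the rotation condition makes [r] an isometry of the line of [a2], so the norm of
     sigma would be a norm from k(a1). *)
  case: h => [[lam [hl [es esg]]]|[es esg]]; last first.
    exfalso; apply: nn; apply/NKE.
    have hr2 : R * A2 * qbar R = A2.
      have := rdata_expand R (p2 : pure A2); move: hs; rewrite es esg => hs.
      rewrite -[A2 * (1 - qbar R)]/(qmul a b a2 (qsub (qone k) (qconj r))) hs.
      rewrite /hm /= !mul0r add0r subrr => /esym /eqP; rewrite subr_eq0 => /eqP; exact: esym.
    have h := fixed_norm hk hD (p2 : pure A2) a20 (ex_intro _ u hu') hr2 r1.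
    have nE : nrm (1 - qbar R) = nrm (1 - R) by rewrite -nrmC qbarB qbar1 qbarK.
    rewrite esg -[qnorm a b _]/(nrm (A2 * (1 - qbar R))) nrmM nE; apply: binorm_mul h.
    by rewrite hu'; apply: binorm_mul (binorm_sqr _ u0); exact: (NK_a1 hD a10).
  pose L : quatalg a b := lam.
  have hz : R * A1 * qbar R + L * A2 * qbar L = A1.
    by apply/(rdata_e1P A2 (p1 : pure A1)); move: hs; rewrite es esg.
  have nNK : ~ NK (nrm (1 - R)).
    move=> h; apply: nn; apply/NKE; rewrite esg.
    exact: (proj2 (NK_sigma hD a10 R)).
  have ez : A1 - R * A1 * qbar R = L * A2 * qbar L.
    by rewrite -[X in X - _]hz addrAC subrr add0r.
  have L0 : L != 0.
    apply/eqP => l0; apply: nNK.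
    apply: (fixed_norm hk hD (p1 : pure A1) a10 _ _ r1).
      by exists 1; rewrite expr1n mulr1.
    by move: hz; rewrite l0 !mul0r addr0.
  have nL0 : nrm L != 0 by rewrite (nrm_eq0 hD).
  have nz : nrm (A1 - R * A1 * qbar R) = nrm L ^+ 2 * nrm A2 by rewrite ez !nrmM nrmC; ring.
  exists r; split=> //; cbv zeta; split.
    by apply/(hilbertN1 _ aniso); split=> //; rewrite -[qnorm a b _]/(nrm (1 - R)) (nrm_eq0 hD).
  rewrite scal_norm -[qnorm a b (qsub _ _)]/(nrm (A1 - R * A1 * qbar R)) nz; split.
    exists (nrm L * u * nrm A1); split; first by apply/eqP; rewrite !mulf_neq0.
    by rewrite -[qnorm a b a1]/(nrm A1) hu'; ring.
  have [n0 vn] := nint _ nL0; right; rewrite vn.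
  by have hL := vge_valE nL0 hl; apply: addr_ge0.
- move=> [r [hr [hil [[w [/eqP w0 hw]] hint]]]] c /eqP c0.
  pose R : quatalg a b := r.
  have [/(_ hil) [n1 nNK] _] := hilbertN1 (qnorm a b (qsub (qone k) r)) aniso.
  have r1 : 1 - R != 0 by rewrite -(nrm_eq0 hD).
  pose z : quatalg a b := A1 - R * A1 * qbar R.
  have pz : pure z.
    apply: (qbar_pure t0); rewrite qbarB !qbarM qbarK (pure_qbar (p1 : pure A1)) mulNr mulrN.
    by rewrite opprB opprK addrC mulrA.
  (* The square condition of (3), transported from [a1] to [a2] through [hu'], is what
     [pure_similar] requires to write [z] as [L * a2 * qbar L]. *)
  have nz : nrm z = nrm A2 * (w / (nrm A1 * u)) ^+ 2.
    apply: (mulIf N10); rewrite [LHS]hw hu'; field.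
    by rewrite u0 N10.
  have wu0 : w / (nrm A1 * u) != 0 by rewrite mulf_neq0 ?invr_eq0 ?mulf_neq0.
  have [L [L0 hL]] := pure_similar hk hD (p2 : pure A2) a20 pz wu0 nz.
  have nL0 : nrm L != 0 by rewrite (nrm_eq0 hD).
  have hl : vge v 0 (nrm L).
    have nz' : nrm z = nrm L ^+ 2 * nrm A2 by rewrite -hL !nrmM nrmC; ring.
    move: hint; rewrite scal_norm -[qnorm a b (qsub _ _)]/(nrm z) nz'.
    have [n0 vn] := nint _ nL0.
    by move=> /(vge_valE n0); rewrite vn -mulr2n pmulrn_lge0 // => ?; right.
  have e : R * A1 * qbar R + L * A2 * qbar L = A1 by rewrite hL addrC subrK.
  have hs := rdata_e1 hD (p1 : pure A1) a10 r1 e.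
  have st := stabilizes_e1 hk hD (p1 : pure A1) a10 r1 hr hl e h21.
  have nsg : ~ NK (nrm (A1 * (1 - qbar R))) by move=> /(NK_sigma hD a10).
  set sg := A1 * _ in hs st nsg.
  have sg0 : nrm sg != 0 by rewrite (nrm_eq0 hD); case: hs.
  have NH n : NK n -> in_H a b a1 a2 v n.
    move=> h; have [l [hl' st' [x [x0 ex]]]] := subfield_spinor_norms hk hD a2 (p1 : pure A1) h.
    by split; [exact/eqP/(binorm_neq0 h) | exists l; split=> //; split=> //; exists x; split=> //; exact/eqP].
  have nA : - nrm A1 != 0 by rewrite oppr_eq0.
  (* By index 2, either [c] is a norm or [c * nrm sg] is; in the latter case composing with the
     rotation [sg] gives [c]. *)
  have [/NH //|/nsg//|/NH] := binorm_index2 hk nA c0 sg0.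
  move=> [_ [l [hl' [[st1 st2] [x [/eqP x0 ex]]]]]]; split; first exact/eqP.
  exists ((((1 - R, - L) : vec k), sg : quat k) :: l); split; first by split=> //; apply/rot_dataE.
  split.
    case: st => st3 st4; split=> [y /st1 /st3 //|y /st4 [y1 [/st2 [y2 [hy2 e2]] e1]]].
    by exists y2; split=> //; rewrite -e1 -e2.
  exists (x / nrm sg); split; first by apply/eqP; rewrite mulf_neq0 ?invr_eq0.
  apply: (mulIf sg0); rewrite ex /= -[qnorm a b sg]/(nrm sg).
  by field.
Qed.
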